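(* Let $\alpha>-1$, $\beta_0\in(-1,0]$. For every $p,q\in\mathbb N$, put $$\mathfrak J_{p,q}(z,w)=\frac{\alpha+\beta_0+2}{\beta_0+1}\,\frac{c_{p,q}}{\overline w^{p-1}z^{q-1}}\ {}_3F_2\left(\left.\begin{array}{c}1,\ \frac{\alpha+\beta_0+3}{2},\ \frac{\alpha+\beta_0+4}{2}\\ \frac{\beta_0+2}{2},\ \frac{\beta_0+3}{2}\end{array}\right|(\overline wz)^2\right).$$ Then the transform $J_{p,q}$ given by $$J_{p,q}f(z)=\int_{\mathbb D}f(w)\,\mathfrak J_{p,q}(z,w)\,d\mu_{\alpha,\beta_0+p}(w)$$ maps isometrically the Hilbert space $\mathcal O_p^2(\mathbb D)$ onto $\mathcal O_q^2(\mathbb D)$, and its inverse $J_{p,q}^{-1}=J_{q,p}:\mathcal O_q^2(\mathbb D)\to\mathcal O_p^2(\mathbb D)$ is given by $$J_{p,q}^{-1}f(w)=\int_{\mathbb D}f(z)\,\mathfrak J_{q,p}(w,z)\,d\mu_{\alpha,\beta_0+q}(z).$$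
   Context: $\mathbb N=\{0,1,2,\dots\}$, $\mathbb D$ is the unit disk, $\mathbb D^*=\mathbb D\setminus\{0\}$, $dA(z)=\frac1\pi\,dx\,dy$, $\mathscr B$ is the beta function. For $\alpha,\beta>-1$, $\mu_{\alpha,\beta}$ is the probability measure on $\mathbb D$ given by $d\mu_{\alpha,\beta}(z)=\frac{|z|^{2\beta}(1-|z|^2)^\alpha}{\mathscr B(\alpha+1,\beta+1)}dA(z)$. $\mathcal A^2(\mathbb D,\mu_{\alpha,\beta})$ is the Hilbert space of holomorphic functions on $\mathbb D^*$ that are square integrable with respect to $\mu_{\alpha,\beta}$, with the $L^2(\mathbb D,\mu_{\alpha,\beta})$ inner product. $(a)_n=a(a+1)\cdots(a+n-1)$ is the Pochhammer symbol, ${}_3F_2\left(\left.\begin{array}{c}a_1,a_2,a_3\\ b_1,b_2\end{array}\right|\xi\right)=\sum_{n=0}^{\infty}\frac{(a_1)_n(a_2)_n(a_3)_n}{(b_1)_n(b_2)_n}\frac{\xi^n}{n!}$. For $p,q,n\ge0$ set $$\gamma_n^p=\sqrt{\frac{(\beta_0+1)_p}{(\alpha+\beta_0+2)_p}\frac{(\alpha+\beta_0+2)_n}{(\beta_0+1)_n}},\qquad c_{p,q}=\sqrt{\frac{(\beta_0+1)_p\,(\beta_0+1)_q}{(\alpha+\beta_0+2)_p\,(\alpha+\beta_0+2)_q}},$$ and $e_n^p(z)=\gamma_n^p\,z^{n-p}$; $(e_n^p)_{n\ge0}$ is an orthonormal basis of $\mathcal A^2(\mathbb D,\mu_{\alpha,\beta_0+p})$.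 $\mathcal O_p^2(\mathbb D)$ is the (closed) Hilbert subspace of $\mathcal A^2(\mathbb D,\mu_{\alpha,\beta_0+p})$ generated by $(e_{2n+1}^p)_{n\ge0}$. (Output variables $z$, $w$ range over $\mathbb D^*$.) *)

(* Defs.v *)
From HB Require Import structures.
From mathcomp Require Import all_boot all_order all_algebra.
From mathcomp Require Import complex.
From mathcomp Require Import all_classical all_reals all_analysis.
From mathcomp Require Import measurable_realfun.

Set Implicit Arguments.
Unset Strict Implicit.
Unset Printing Implicit Defensive.

Import Order.TTheory GRing.Theory Num.Theory.
Import numFieldNormedType.Exports.

Local Open Scope classical_set_scope.
Local Open Scope complex_scope.
Local Open Scope ring_scope.

Section special_functions.

Definition pochhammer (K : nzRingType) (a : K) (n : nat) : K :=
  \prod_(i < n) (a + i%:R).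

(* The sum is the limit of the partial sums in [K]; it carries information
   only where the series converges. *)
Definition hypergeometric3F2 (K : numFieldType) (a1 a2 a3 b1 b2 xi : K) : K :=
  limn (series (fun n : nat =>
    pochhammer a1 n * pochhammer a2 n * pochhammer a3 n
      / (pochhammer b1 n * pochhammer b2 n) * (xi ^+ n / n`!%:R))).

(* Euler's integral for real arguments; the library's [beta_fun] only takes
   natural numbers. *)
Definition Beta (R : realType) (a b : R) : R :=
  \int[lebesgue_measure]_(t in `]0, 1[) (t `^ (a - 1) * (1 - t) `^ (b - 1)).

End special_functions.

Section disk.
Variable R : realType.

Definition absc (z : R[i]) : R := ComplexField.Normc.normc z.

Definition Dstar : set R[i] := [set z | 0 < absc z < 1].

(* Measures live on [R * R], which has the product sigma-algebra, whereas
   [R[i]] carries the field structure and the topology. *)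
Definition toC (u : R * R) : R[i] := u.1 +i* u.2.

Definition disk : set (R * R) := [set u | absc (toC u) < 1].

Definition mu_density (alpha beta : R) : R * R -> R :=
  (fun u => absc (toC u) `^ (2 * beta) * (1 - absc (toC u) ^+ 2) `^ alpha
            / Beta (alpha + 1) (beta + 1) / pi) \_ disk.

Lemma measurable_absc : measurable_fun setT (absc \o toC).
Proof.
apply: measurableT_comp; last first.
  by apply: measurable_funD; apply: measurable_funX.
apply: continuous_measurable_fun; exact: sqrt_continuous.
Qed.

Lemma measurable_disk : measurable disk.
Proof.
rewrite (_ : disk = (absc \o toC) @^-1` `]-oo, 1[).
  by rewrite -[X in measurable X]setTI; exact: measurable_absc.
by apply/seteqP; split => u /=; rewrite in_itv.
Qed.

Lemma measurable_mu_density alpha beta :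
  measurable_fun setT (mu_density alpha beta).
Proof.
apply/(measurable_restrictT _ measurable_disk).
apply: (measurable_funS (E := setT)) => //.
apply: measurable_funM => //; apply: measurable_funM => //.
apply: measurable_funM.
  apply: (@measurableT_comp _ _ _ _ _ _ (@powR R ^~ (2 * beta))) => //.
  exact: measurable_absc.
apply: (@measurableT_comp _ _ _ _ _ _ (@powR R ^~ alpha)) => //.
by apply: measurable_funB => //; apply: measurable_funX;
  exact: measurable_absc.
Qed.

Lemma Beta_ge0 (a b : R) : 0 <= Beta a b.
Proof.
by apply: Rintegral_ge0 => t _; rewrite mulr_ge0 ?powR_ge0.
Qed.

Lemma mu_density_ge0 alpha beta u : 0 <= mu_density alpha beta u.
Proof.
rewrite /mu_density patchE; case: ifP => // _.
by rewrite !mulr_ge0 ?powR_ge0 ?invr_ge0 ?Beta_ge0 ?pi_ge0.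
Qed.

Definition mu (alpha beta : R) : set (R * R) -> \bar R :=
  fun A => (\int[lebesgue_measure \x lebesgue_measure]_(u in A) (mu_density alpha beta u)%:E)%E.

Section mu_is_measure.
Variables alpha beta : R.

Let mu0 : mu alpha beta set0 = 0%E.
Proof. exact: integral_set0. Qed.

Let mu_ge0 A : (0 <= mu alpha beta A)%E.
Proof. by apply: integral_ge0 => u _; rewrite lee_fin mu_density_ge0. Qed.

Let mu_sigma_additive : semi_sigma_additive (mu alpha beta).
Proof.
move=> /= F mF tF mUF; rewrite /mu; apply: cvg_toP.
  apply: ereal_nondecreasing_is_cvgn => m n mn.
  apply: lee_sum_nneg_natr => // k _ _.
  by apply: integral_ge0 => /= x Fkx; rewrite lee_fin mu_density_ge0.
rewrite ge0_integral_bigcup//=.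
- apply: measurable_funTS; apply: measurableT_comp => //.
  exact: measurable_mu_density.
- by move=> x _; rewrite lee_fin mu_density_ge0.
Qed.

HB.instance Definition _ := isMeasure.Build _ _ _ (mu alpha beta)
  mu0 mu_ge0 mu_sigma_additive.

End mu_is_measure.

Definition Cintegrable (alpha beta : R) (F : R[i] -> R[i]) : Prop :=
  (mu alpha beta).-integrable disk (fun u => (complex.Re (F (toC u)))%:E) /\
  (mu alpha beta).-integrable disk (fun u => (complex.Im (F (toC u)))%:E).

Definition Cintegral (alpha beta : R) (F : R[i] -> R[i]) : R[i] :=
  (\int[mu alpha beta]_(u in disk) complex.Re (F (toC u))) +i*
  (\int[mu alpha beta]_(u in disk) complex.Im (F (toC u))).

Definition holomorphic_on (D : set R[i]) (f : R[i] -> R[i]) : Prop :=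
  forall z, D z -> derivable (f : R[i]^o -> R[i]^o) z 1.

(* A function on the punctured disk is represented by a total function on
   [R[i]] whose values outside [Dstar] are irrelevant; equality of elements is
   equality on [Dstar]. *)
Definition A2 (alpha beta : R) : set (R[i] -> R[i]) :=
  [set f | holomorphic_on Dstar f /\
    (mu alpha beta).-integrable disk (fun u => (absc (f (toC u)) ^+ 2)%:E)].

Definition L2dot (alpha beta : R) (f g : R[i] -> R[i]) : R[i] :=
  Cintegral alpha beta (fun z => f z * (g z)^*).

Definition L2norm (alpha beta : R) (f : R[i] -> R[i]) : R :=
  Num.sqrt (complex.Re (L2dot alpha beta f f)).

End disk.

Section kernels.
Variables (R : realType) (alpha beta0 : R).

Definition gamma_coef (p n : nat) : R :=
  Num.sqrt (pochhammer (beta0 + 1) p / pochhammer (alpha + beta0 + 2) p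
            * (pochhammer (alpha + beta0 + 2) n / pochhammer (beta0 + 1) n)).

Definition c_coef (p q : nat) : R :=
  Num.sqrt (pochhammer (beta0 + 1) p * pochhammer (beta0 + 1) q
            / (pochhammer (alpha + beta0 + 2) p
               * pochhammer (alpha + beta0 + 2) q)).

Definition e_fun (p n : nat) (z : R[i]) : R[i] :=
  (gamma_coef p n)%:C * z ^ (n%:Z - p%:Z).

(* The closure, in the norm of [A2], of the linear span of the [e_fun p n]
   with [n] odd. *)
Definition O2 (p : nat) : set (R[i] -> R[i]) :=
  [set f | A2 alpha (beta0 + p%:R) f /\
    forall eps : R, 0 < eps -> exists (N : nat) (a : nat -> R[i]),
      L2norm alpha (beta0 + p%:R)
        (fun z => f z - \sum_(n < N) a n * e_fun p (2 * n).+1 z) < eps].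

Definition J_kernel (p q : nat) (z w : R[i]) : R[i] :=
  ((alpha + beta0 + 2) / (beta0 + 1))%:C
  * ((c_coef p q)%:C / (w^* ^ (p%:Z - 1) * z ^ (q%:Z - 1)))
  * hypergeometric3F2 1
      ((alpha + beta0 + 3) / 2)%:C ((alpha + beta0 + 4) / 2)%:C
      ((beta0 + 2) / 2)%:C ((beta0 + 3) / 2)%:C
      ((w^* * z) ^+ 2).

Definition J_transform (p q : nat) (f : R[i] -> R[i]) (z : R[i]) : R[i] :=
  Cintegral alpha (beta0 + p%:R) (fun w => f w * J_kernel p q z w).

End kernels.

(* Main.v *)
Require Import Defs.
From HB Require Import structures.
From mathcomp Require Import all_boot all_order all_algebra.
From mathcomp Require Import complex.
From mathcomp Require Import all_classical all_reals all_analysis.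
From mathcomp Require Import measurable_realfun ring lra.

(** The space O_p has the orthonormal basis e_(2n+1)^p, so the only candidate for
an isometry that respects these bases is the map sending the coefficient
sequence of f to the function with the same coefficients in O_q.  The theorem
says that J_(p,q) is this map, and everything about J_(p,q) follows from that:
it is isometric by Parseval, and J_(q,p) undoes it because it acts trivially
on coefficients as well.

The kernel.  Since (a)_(2n+1) = a 4^n ((a+1)/2)_n ((a+2)/2)_n, the quotient of
Pochhammer symbols in gamma_(2n+1)^p gamma_(2n+1)^q is the coefficient of the
hypergeometric series ([gamma_mul_odd]), whence

  J(z, w) = sum_n conj(e_(2n+1)^p(w)) e_(2n+1)^q(z)     ([kernel_conv]).

The conjugates of e_(2n+1)^q(z) form a square-summable sequence, so the
conjugate of J(z, .) lies in O_p ([conj_kernel_L2]), the integral defining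
J f(z) is an inner product, and expanding f in the basis gives
J f(z) = sum_n <f, e_(2n+1)^p> e_(2n+1)^q(z)            ([J_expand]).

Orthonormality.  The monomials z^(n-p) and z^(k-p) are orthogonal because mu is
invariant under rotations; Lebesgue measure on the plane is, since a rotation
is a product of three shears and each shear is a translation on every line
([ge0_integral_rotation]).  The norms reduce, by integrating radial functions
([ge0_integral_radial]), to Beta(alpha+1, beta0+n+1), which is evaluated with
the recursion of the beta function ([Beta_pochhammer]).

Expansion.  A square-summable sequence b defines z^(1-p) times a power series
in z^2, hence a holomorphic function on the punctured disk.  Fatou's lemma
passes from pointwise to L2 convergence of the partial sums
([odd_series_tail]); conversely, an f in O_p and the series of its coefficients
are at L2-distance 0, and two holomorphic functions at distance 0 are equal
since a nonzero value persists on a box of positive measure ([O2_expand]). *)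

Set Implicit Arguments.
Unset Strict Implicit.
Unset Printing Implicit Defensive.

Import Order.TTheory GRing.Theory Num.Theory.
Import numFieldNormedType.Exports.

Local Open Scope classical_set_scope.
Local Open Scope complex_scope.
Local Open Scope ring_scope.

(** * Integration against a measure given by a density *)

Section density.
Context d (T : measurableType d) (R : realType).
Variables (m nu : {measure set T -> \bar R}) (g : T -> R).
Hypothesis mg : measurable_fun setT g.
Hypothesis g0 : forall x, 0 <= g x.
Hypothesis nuE : forall A, measurable A -> nu A = (\int[m]_(x in A) (g x)%:E)%E.
Import HBNNSimple.
Local Open Scope ereal_scope.

(** The identity is the hypothesis [nuE] for indicators; both sides are additive
and continuous along increasing sequences, so it extends to simple functions
and then to their monotone limits. *)
Lemma ge0_integral_density (D : set T) (F : T -> \bar R) : measurable D ->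
  measurable_fun D F -> (forall x, D x -> 0 <= F x) ->
  \int[nu]_(x in D) F x = \int[m]_(x in D) (F x * (g x)%:E).
Proof.
move=> mD mF F0; pose f_ := nnsfun_approx mD mF.
have f_F x : D x -> (f_ n x)%:E @[n --> \oo] --> F x.
  by move=> Dx; apply: cvg_nnsfun_approx => //.
have mfg n : measurable_fun D (fun x => (f_ n x)%:E * (g x)%:E).
  apply: emeasurable_funM; apply/measurable_EFinP => //.
    exact: measurable_funTS.
  exact: measurable_funTS.
transitivity (limn (fun n => \int[nu]_(x in D) (f_ n x)%:E)).
  rewrite -monotone_convergence//.
  - by apply: eq_integral => y /[!inE] yD; apply/esym/cvg_lim => //; exact: f_F.
  - by move=> n; apply/measurable_EFinP; exact: measurable_funTS.
  - by move=> n y _; rewrite lee_fin.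
  - by move=> y _ k n kn; rewrite lee_fin; exact/lefP/nd_nnsfun_approx.
transitivity (limn (fun n => \int[m]_(x in D) ((f_ n x)%:E * (g x)%:E))); last first.
  rewrite -monotone_convergence//.
  - apply: eq_integral => y /[!inE] yD; apply/cvg_lim => //.
    by apply: cvgeZr => //; exact: f_F.
  - by move=> n y _; rewrite mule_ge0 ?lee_fin.
  - move=> y _ k n kn; rewrite lee_wpmul2r ?lee_fin//.
    exact/lefP/nd_nnsfun_approx.
congr (limn _); apply/funext => n.
have mk r : measurable (f_ n @^-1` [set r]) by [].
under eq_integral do rewrite fimfunE -fsumEFin//.
rewrite ge0_integral_fsum//; last 2 first.
- move=> r; apply/measurable_EFinP; apply: measurable_funM => //.
- by move=> y x _; rewrite nnfun_muleindic_ge0.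
under [RHS]eq_integral.
  move=> x xD; rewrite fimfunE -fsumEFin// ge0_mule_fsuml; last first.
    by move=> r; have := nnfun_muleindic_ge0 (f_ n) r x.
  over.
rewrite /= ge0_integral_fsum//; last 2 first.
- move=> r; apply: emeasurable_funM; apply/measurable_EFinP; last first.
    exact: measurable_funTS.
  exact: measurable_funM.
- by move=> y x _; apply: mule_ge0; rewrite ?lee_fin// -lee_fin EFinM nnfun_muleindic_ge0.
apply: eq_fsbigr => r _.
rewrite integralZl_indic_nnsfun// integral_indic// nuE; last exact: measurableI.
have [r0|r0] := ltP r 0%R.
  rewrite preimage_nnfun0// set0I integral_set0 mule0.
  under eq_integral do rewrite indic0 mulr0 mul0e.
  by rewrite integral0.
under [RHS]eq_integral do rewrite EFinM -muleA.
rewrite ge0_integralZl//; last 2 first.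
- apply: emeasurable_funM; apply/measurable_EFinP => //; exact: measurable_funTS.
- by move=> x _; rewrite mule_ge0 ?lee_fin.
congr (_ * _).
rewrite setIC integral_mkcondr; apply: eq_integral => x _.
by rewrite epatch_indic muleC.
Qed.

End density.

(** * Translations, shears and rotations *)

Section plane.
Variable R : realType.
Local Notation mu1 := (@lebesgue_measure R).
Local Notation lambda2 := (@lebesgue_measure R \x @lebesgue_measure R)%E.

(** Lebesgue measure is the only measure with the right values on half-open
intervals, and a translation preserves lengths. *)
Lemma lebesgue_measure_shift (c : R) (A : set R) : measurable A ->
  pushforward mu1 (fun x : R => x + c : measurableTypeR R) A = mu1 A.
Proof.
move=> mA.
have mc : measurable_fun setT (fun x : measurableTypeR R => x + c : measurableTypeR R).
  exact: measurable_funD.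
pose c' := isMeasurableFun.Build _ _ _ _ _ mc.
pose f : {mfun _ >-> _} := HB.pack (fun x : measurableTypeR R => x + c : measurableTypeR R) c'.
apply/esym/(@lebesgue_measure_unique _ (pushforward mu1 f)) => //= _ [[a b]] _ <-.
rewrite /pushforward.
rewrite [X in lebesgue_measure X = _](_ : _ = `]a, b]%classic)//.
rewrite [X in _ = lebesgue_measure X](_ : _ = `]a - c, b - c]%classic)//.
  rewrite !lebesgue_measure_itv/= !lte_fin ltrD2r.
  by rewrite -!EFinB opprB addrA subrK.
by apply/seteqP; split => x /=; rewrite !in_itv/= ltrBlDr lerBrDr.
Qed.

Lemma ge0_integral_shift (f : R -> \bar R) (c : R) :
  measurable_fun setT f -> (forall x, 0 <= f x)%E ->
  (\int[mu1]_x f (x + c)%R = \int[mu1]_x f x)%E.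
Proof.
move=> mf f0.
have mc : measurable_fun setT (fun x : measurableTypeR R => x + c : measurableTypeR R).
  exact: measurable_funD.
have := ge0_integral_pushforward mc mu1 measurableT mf (fun y _ => f0 y).
rewrite preimage_setT => <-.
by apply: eq_measure_integral => //= A mA _; exact: lebesgue_measure_shift.
Qed.

Lemma fubini_plane1 (F : R * R -> \bar R) :
  measurable_fun setT F -> (forall u, 0 <= F u)%E ->
  (\int[lambda2]_u F u = \int[mu1]_x \int[mu1]_y F (x, y))%E.
Proof.
exact: (@fubini_tonelli1 _ _ (measurableTypeR R) (measurableTypeR R) R mu1 mu1).
Qed.

Lemma fubini_plane2 (F : R * R -> \bar R) :
  measurable_fun setT F -> (forall u, 0 <= F u)%E ->
  (\int[lambda2]_u F u = \int[mu1]_y \int[mu1]_x F (x, y))%E.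
Proof.
exact: (@fubini_tonelli2 _ _ (measurableTypeR R) (measurableTypeR R) R mu1 mu1).
Qed.

(** On each horizontal line a shear is a translation, so Tonelli reduces the
invariance to dimension one. *)
Lemma ge0_integral_shearl (F : R * R -> \bar R) (c : R) :
  measurable_fun setT F -> (forall u, 0 <= F u)%E ->
  (\int[lambda2]_u F (u.1 + c * u.2, u.2)%R = \int[lambda2]_u F u)%E.
Proof.
move=> mF F0.
have mG : measurable_fun setT (fun u : R * R => F (u.1 + c * u.2, u.2)).
  apply: (measurableT_comp mF); apply/measurable_fun_pair => //=.
  by apply: measurable_funD => //; apply: measurable_funM.
rewrite (fubini_plane2 mG (fun u => F0 _)) (fubini_plane2 mF F0).
apply: eq_integral => y _.
apply: (ge0_integral_shift (f := fun x => F (x, y)) (c * y)) => //.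
exact: measurableT_comp.
Qed.

Lemma ge0_integral_shearr (F : R * R -> \bar R) (c : R) :
  measurable_fun setT F -> (forall u, 0 <= F u)%E ->
  (\int[lambda2]_u F (u.1, u.2 + c * u.1)%R = \int[lambda2]_u F u)%E.
Proof.
move=> mF F0.
have mG : measurable_fun setT (fun u : R * R => F (u.1, u.2 + c * u.1)).
  apply: (measurableT_comp mF); apply/measurable_fun_pair => //=.
  by apply: measurable_funD => //; apply: measurable_funM.
rewrite (fubini_plane1 mG (fun u => F0 _)) (fubini_plane1 mF F0).
apply: eq_integral => x _.
apply: (ge0_integral_shift (f := fun y => F (x, y)) (c * x)) => //.
exact: measurableT_comp.
Qed.

(** A rotation is a product of three shears: a horizontal one with ratio
a = (c - 1) / s, a vertical one with ratio s, and the first one again.  This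
decomposition needs s to be nonzero, which excludes the rotations by 0 and pi.
It avoids the change of variables formula in the plane. *)
Lemma ge0_integral_rotation (F : R * R -> \bar R) (c s : R) :
  c ^+ 2 + s ^+ 2 = 1 -> s != 0 ->
  measurable_fun setT F -> (forall u, 0 <= F u)%E ->
  (\int[lambda2]_u F (c * u.1 - s * u.2, s * u.1 + c * u.2)%R
    = \int[lambda2]_u F u)%E.
Proof.
move=> cs1 s0 mF F0; pose a := (c - 1) / s.
have mshearl (G : R * R -> \bar R) : measurable_fun setT G ->
    measurable_fun setT (fun u : R * R => G (u.1 + a * u.2, u.2)).
  move=> mG; apply: (measurableT_comp mG); apply/measurable_fun_pair => //=.
  by apply: measurable_funD => //; apply: measurable_funM.
have mshearr (G : R * R -> \bar R) : measurable_fun setT G ->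
    measurable_fun setT (fun u : R * R => G (u.1, u.2 + s * u.1)).
  move=> mG; apply: (measurableT_comp mG); apply/measurable_fun_pair => //=.
  by apply: measurable_funD => //; apply: measurable_funM.
(* apply the three shears to the right-hand side, the outermost one first *)
rewrite -[RHS](ge0_integral_shearl a mF F0).
rewrite -[RHS](ge0_integral_shearr s (mshearl _ mF))//.
rewrite -[RHS](ge0_integral_shearl a (mshearr _ (mshearl _ mF)))//=.
have as1 : a * s = c - 1 by rewrite /a divfK.
have ac1 : a * (1 + c) = - s.
  have cE : (c - 1) * (1 + c) = - s ^+ 2.
    transitivity (c ^+ 2 - 1); first by ring.
    by rewrite -[X in _ - X]cs1; ring.
  by rewrite /a mulrAC cE expr2 mulNr mulfK.
apply: eq_integral => -[x y] _ /=; congr (F (_, _)).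
  transitivity ((1 + a * s) * x + a * (1 + (1 + a * s)) * y); last by ring.
  by rewrite as1 (addrC 1 (c - 1)) subrK ac1 mulNr.
transitivity ((1 + a * s) * y + s * x); last by ring.
by rewrite as1 (addrC 1 (c - 1)) subrK addrC.
Qed.

End plane.

(** * The area of a disk and radial integrals *)

Section area.
Variable R : realType.
Local Notation mu1 := (@lebesgue_measure R).
Local Notation lambda2 := (@lebesgue_measure R \x @lebesgue_measure R)%E.

(** The substitution x = r sin t turns the integrand into 2 r^2 cos^2 t, whose
primitive is r^2 (t + sin t cos t). *)
Lemma integral_half_circle (r : R) : 0 <= r ->
  (\int[mu1]_(x in `[(- r)%R, r]) (2 * Num.sqrt (r ^+ 2 - x ^+ 2))%:E
    = (pi * r ^+ 2)%:E)%E.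
Proof.
rewrite le_eqVlt => /predU1P[<-|r0].
  by rewrite oppr0 set_itv1 integral_set1 expr0n mulr0.
have pi0 : 0 < pi / 2 :> R by rewrite divr_gt0// pi_gt0.
pose F := fun t : R => r * sin t.
have dF (t : R) : is_derive t 1 F (r * cos t).
  by rewrite /F; apply: is_derive_eq.
have F'E : (F^`())%classic = fun t => r * cos t.
  by apply/funext => t; rewrite derive1E; apply: derive_val.
have cF : continuous F.
  by move=> t; apply/differentiable_continuous/derivable1_diffP; exact: ex_derive.
have cF' : continuous (F^`())%classic.
  rewrite F'E => t; apply: cvgM; [exact: cvg_cst|exact: continuous_cos].
have FN : F (- (pi / 2)) = - r by rewrite /F sinN sin_pihalf mulrN1.
have FP : F (pi / 2) = r by rewrite /F sin_pihalf mulr1.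
rewrite -{1}FN -[in X in `[_, X]%classic]FP.
rewrite integration_by_substitution_increasing; last first.
- apply: continuous_subspaceT => x; apply: cvgM; first exact: cvg_cst.
  apply: continuous_comp; last exact: sqrt_continuous.
  by apply: cvgB; [exact: cvg_cst|exact: exprn_continuous].
- split; first by move=> t _; exact: ex_derive.
  + by apply: cvg_at_right_filter; exact: cF.
  + by apply: cvg_at_left_filter; exact: cF.
- by apply/cvg_ex; eexists; apply: cvg_at_left_filter; exact: cF'.
- by apply/cvg_ex; eexists; apply: cvg_at_right_filter; exact: cF'.
- by move=> t _; exact: cF'.
- by move=> x y xI yI xy; rewrite /F ltr_pM2l// ltr_sin.
- by rewrite ltW// gtrN.
pose G := fun t : R => r ^+ 2 * (t + sin t * cos t).
have dG (t : R) : is_derive t 1 G (r ^+ 2 * (2 * cos t ^+ 2)).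
  rewrite /G; apply: is_derive_eq.
  congr (_ * _); rewrite -[X in X + _](cos2Dsin2 t) /GRing.scale/=; ring.
transitivity (\int[mu1]_(x in `[(- (pi / 2))%R, (pi / 2)%R]) (r ^+ 2 * (2 * cos x ^+ 2))%:E)%E.
  apply: eq_integral => t; rewrite inE/= in_itv/= => tI; congr EFin.
  have ct : 0 <= cos t by apply: cos_ge0_pihalf.
  rewrite F'E; transitivity (2 * Num.sqrt (r ^+ 2 - (r * sin t) ^+ 2) * (r * cos t)).
    by [].
  have -> : r ^+ 2 - (r * sin t) ^+ 2 = (r * cos t) ^+ 2.
    by rewrite !exprMn cos2sin2; ring.
  by rewrite sqrtr_sqr (ger0_norm (mulr_ge0 (ltW r0) ct)); ring.
rewrite (@continuous_FTC2 _ _ G).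
- rewrite -EFinB /G cosN cos_pihalf !mulr0 !addr0; congr EFin.
  by rewrite -mulrBr opprK -splitr mulrC.
- by rewrite gtrN.
- apply: continuous_subspaceT => x; apply: cvgM; first exact: cvg_cst.
  apply: cvgM; first exact: cvg_cst.
  by apply: (@cvgM _ _ _ _ cos cos); exact: continuous_cos.
- have cG : continuous G.
    by move=> t; apply/differentiable_continuous/derivable1_diffP; exact: ex_derive.
  split; first by move=> t _; exact: ex_derive.
  + by apply: cvg_at_right_filter; exact: cG.
  + by apply: cvg_at_left_filter; exact: cG.
- by move=> t _; rewrite derive1E; apply: derive_val.
Qed.

(** Radial integrals are written in terms of the squared radius t = x^2 + y^2: the
area of the disk is then linear in t, and the image of Lebesgue measure is a
multiple of Lebesgue measure. *)
Definition normsq (u : R * R) : R := u.1 ^+ 2 + u.2 ^+ 2.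

Lemma measurable_normsq : measurable_fun setT normsq.
Proof. by apply: measurable_funD; apply: measurable_funX. Qed.

Lemma lebesgue_measure_sqr_lt (s : R) :
  (mu1 [set y : R | (y ^+ 2 < s)%R] = (2 * Num.sqrt s)%:E)%E.
Proof.
have [s0|s0] := ltP s 0.
  rewrite (_ : [set _ | _] = set0) ?measure0 ?ltr0_sqrtr ?mulr0//.
  by apply/seteqP; split => y //=; rewrite ltNge (le_trans (ltW s0) (sqr_ge0 y)).
rewrite (_ : [set _ | _] = `]- Num.sqrt s, Num.sqrt s[%classic).
  rewrite lebesgue_measure_itv/= lte_fin; case: ltP => [_|].
    by rewrite -EFinB opprK mulr2n mulrDl mul1r.
  by move=> rN; congr EFin; have := sqrtr_ge0 s; lra.
have ltE y : (y ^+ 2 < s) = (`|y| < Num.sqrt s).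
  rewrite -[in LHS](sqr_sqrtr s0) -(real_normK (num_real y)).
  by rewrite ltr_pXn2r// nnegrE ?sqrtr_ge0.
by apply/seteqP; split => y /=; rewrite in_itv/= -ltr_norml ltE.
Qed.

(** The slice of the disk at abscissa x is the interval of half-length
sqrt (t - x^2), so Tonelli leaves the integral of the half circle. *)
Lemma disk_area (t : R) : 0 <= t ->
  lambda2 [set u | (normsq u < t)%R] = (pi * t)%:E.
Proof.
move=> t0.
have mA : measurable [set u : R * R | normsq u < t].
  have -> : [set u | normsq u < t] = normsq @^-1` `]-oo, t[.
    by apply/seteqP; split => u; rewrite /= in_itv.
  by rewrite -[X in measurable X]setTI; exact: measurable_normsq.
have mI : measurable_fun setT (fun u : R * R => (\1_[set u | normsq u < t] u : R)%:E).
  by apply/measurable_EFinP; exact: measurable_indic.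
transitivity (\int[lambda2]_u (\1_[set u | (normsq u < t)%R] u : R)%:E)%E.
  by rewrite integral_indic// setIT.
rewrite (fubini_plane1 mI); last by move=> u; rewrite lee_fin.
transitivity (\int[mu1]_(x in `[(- Num.sqrt t)%R, Num.sqrt t])
    (2 * Num.sqrt (Num.sqrt t ^+ 2 - x ^+ 2))%:E)%E; last first.
  by rewrite integral_half_circle ?sqrtr_ge0// sqr_sqrtr.
rewrite sqr_sqrtr// [RHS]integral_mkcond; apply: eq_integral => x _.
transitivity (mu1 [set y : R | y ^+ 2 < t - x ^+ 2]).
  rewrite -[LHS]/(\int[mu1]_y (\1_[set u | (normsq u < t)%R] (x, y))%:E)%E.
  transitivity (\int[mu1]_y (\1_[set y : R | (y ^+ 2 < t - x ^+ 2)%R] y)%:E)%E.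
    apply: eq_integral => y _; congr EFin.
    rewrite !indicE; congr (_ %:R); congr nat_of_bool.
    by apply/idP/idP; rewrite !inE/= /normsq/=; lra.
  rewrite integral_indic ?setIT//.
  have -> : [set y : R | y ^+ 2 < t - x ^+ 2] = (fun y => y ^+ 2) @^-1` `]-oo, t - x ^+ 2[.
    by apply/seteqP; split => u; rewrite /= in_itv.
  rewrite -[X in measurable X]setTI.
  by apply: measurable_funX.
rewrite lebesgue_measure_sqr_lt patchE; case: ifPn => //.
rewrite notin_setE/= in_itv/= -ler_norml => /negP; rewrite -ltNge => xt.
rewrite ltr0_sqrtr ?mulr0// subr_lt0.
by rewrite -(sqr_sqrtr t0) -(real_normK (num_real x)) ltr_pXn2r// nnegrE ?sqrtr_ge0.
Qed.

(** The image of Lebesgue measure under [normsq] and pi times Lebesgue measure on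
the half-line agree on the half-lines ]-oo, x[ by [disk_area]; these generate
the Borel sets and are stable under intersection. *)
Lemma ge0_integral_radial (h : R -> \bar R) :
  measurable_fun setT h -> (forall t, 0 <= h t)%E ->
  (\int[lambda2]_u h (normsq u) = pi%:E * \int[mu1]_(t in `[0%R, +oo[) h t)%E.
Proof.
move=> mh h0; have pi0 : 0 <= pi :> R := pi_ge0 R.
pose c : {nonneg R} := NngNum pi0.
have mD : measurable (`[0, +oo[%classic : set (measurableTypeR R)).
  exact: measurable_itv.
have mn : @measurable_fun _ _ (R * R)%type (measurableTypeR R) setT normsq.
  exact: measurable_normsq.
pose nm := isMeasurableFun.Build _ _ _ _ _ mn.
pose f : {mfun _ >-> _} := HB.pack (normsq : (R * R)%type -> measurableTypeR R) nm.
pose m1_ : {measure set (measurableTypeR R) -> \bar R} := pushforward lambda2 f.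
pose m1 := m1_ mn.
pose m2 : {measure set (measurableTypeR R) -> \bar R} := mscale c (mrestr mu1 mD).
have m12 A : measurable A -> m1 A = m2 A.
  pose G : set (set (measurableTypeR R)) := [set A | exists x, A = `]-oo, x[%classic].
  pose g : (set (measurableTypeR R))^nat := fun k => `]-oo, k%:R[%classic.
  apply: (@measure_unique _ _ (measurableTypeR R) G g).
  - exact: RGenInftyO.measurableE.
  - move=> _ _ [x ->] [y ->]; exists (Num.min x y).
    by apply/seteqP; split => z; rewrite /= !in_itv/= lt_min; [case=> -> ->|move/andP].
  - by move=> i; rewrite /G /g /=; exists i%:R.
  - apply/seteqP; split => // x _.
    exists (Num.truncn `|x : R|).+1 => //; rewrite /g/= in_itv/=.
    by rewrite (le_lt_trans (ler_norm (x : R)))// truncnS_gt.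
  - move=> _ [x ->].
    transitivity (lambda2 (normsq @^-1` `]-oo, x[)); first by [].
    transitivity (pi%:E * mu1 (`]-oo, x[ `&` `[0%R, +oo[))%E; last by [].
    have -> : normsq @^-1` `]-oo, x[ = [set u | normsq u < x].
      by apply/seteqP; split => u; rewrite /= in_itv.
    have [x0|x0] := leP 0 x.
      rewrite disk_area//.
      rewrite (_ : _ `&` _ = `[0, x[%classic); last first.
        by apply/seteqP; split => z; rewrite /= !in_itv/= ?andbT; [case=> -> ->|move/andP => []].
      rewrite lebesgue_measure_itv/= lte_fin; case: ltP => [_|xx0].
        by rewrite sube0 EFinM.
      by rewrite mule0 (_ : x = 0) ?mulr0//; apply/eqP; rewrite eq_le x0 xx0.
    rewrite (_ : [set u | _] = set0); last first.
      apply/seteqP; split => // u /=; apply/negP; rewrite -leNgt.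
      by rewrite (le_trans (ltW x0))// addr_ge0 ?sqr_ge0.
    rewrite (_ : _ `&` _ = set0) ?measure0 ?mule0//.
    apply/seteqP; split => // z [] /=; rewrite !in_itv/= andbT => zx z0.
    by move: x0; rewrite ltNge => /negP; apply; rewrite (le_trans z0 (ltW zx)).
  - move=> k; rewrite [ltLHS](_ : _ = lambda2 [set u | normsq u < k%:R]).
      by rewrite disk_area ?ltry.
    rewrite -[LHS]/(lambda2 (normsq @^-1` `]-oo, k%:R[)).
    by congr (lambda2 _); apply/seteqP; split => u; rewrite /= in_itv.
have mh' : measurable_fun (`[0, +oo[%classic : set (measurableTypeR R)) h.
  exact: measurable_funTS.
transitivity (\int[m1]_(t in `[0%R, +oo[) h t)%E.
  rewrite ge0_integral_pushforward//.
  rewrite (_ : f @^-1` _ = setT)//.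
  by apply/seteqP; split => // u _; rewrite /= in_itv/= andbT addr_ge0 ?sqr_ge0.
rewrite (eq_measure_integral (mscale c mu1)); last first.
  move=> A mA AD; rewrite [LHS]m12//.
  by apply: (congr1 (fun B => pi%:E * mu1 B)%E); exact: setIidl.
by rewrite ge0_integral_mscale.
Qed.

End area.

(** * Euler's beta integral *)

Section beta.
Variable R : realType.
Local Notation mu1 := (@lebesgue_measure R).
Implicit Types a b t : R.

Definition beta_integrand (a b t : R) : R := t `^ (a - 1) * (1 - t) `^ (b - 1).

(** The integral as an extended real: identities between nonnegative integrals hold
in this form without any integrability, and finiteness ([betaE_lty]) is
deduced from them. *)
Definition betaE (a b : R) : \bar R :=
  (\int[mu1]_(t in `]0%R, 1%R[) (beta_integrand a b t)%:E)%E.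

Lemma BetaE (a b : R) : Beta a b = fine (betaE a b).
Proof. by []. Qed.

Lemma beta_integrand_ge0 a b t : 0 <= beta_integrand a b t.
Proof. by rewrite mulr_ge0 ?powR_ge0. Qed.

Lemma measurable_beta_integrand a b : measurable_fun setT (beta_integrand a b).
Proof.
apply: measurable_funM; first exact: measurable_powR.
apply: (@measurableT_comp _ _ _ _ _ _ (@powR R ^~ (b - 1))).
  exact: measurable_powR.
exact: measurable_funB.
Qed.

Lemma betaE_ge0 a b : (0 <= betaE a b)%E.
Proof. by apply: integral_ge0 => t _; rewrite lee_fin beta_integrand_ge0. Qed.

Lemma powR_recl (x c : R) : 0 < x -> x `^ c = x * x `^ (c - 1).
Proof.
move=> x0; rewrite -{2}(powRr1 (ltW x0)) -powRD; first by rewrite addrC subrK.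
by rewrite (gt_eqF x0) implybT.
Qed.

(** Insert 1 = (1 - t) + t in the integrand. *)
Lemma betaE_split a b : betaE a b = (betaE a (b + 1) + betaE (a + 1) b)%E.
Proof.
rewrite -ge0_integralD//=; last 4 first.
- by move=> t _; rewrite lee_fin beta_integrand_ge0.
- by apply/measurable_EFinP/measurable_funTS; exact: measurable_beta_integrand.
- by move=> t _; rewrite lee_fin beta_integrand_ge0.
- by apply/measurable_EFinP/measurable_funTS; exact: measurable_beta_integrand.
apply: eq_integral => t; rewrite inE/= in_itv/= => /andP[t0 t1].
rewrite -EFinD; congr EFin; rewrite /beta_integrand !addrK.
rewrite (powR_recl a t0) (@powR_recl (1 - t) b) ?subr_gt0//; ring.
Qed.

Lemma cvg_inv_shift3 : (fun n => (n.+3%:R : R)^-1) @ \oo --> 0.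
Proof. by have := @cvg_harmonic R; rewrite -(cvg_shiftn 2)/= => h; under eq_fun do rewrite -addn2; exact: h. Qed.

Lemma beta_prod_derive a b t : 0 < t < 1 ->
  is_derive t 1 (fun t : R => t `^ a * (1 - t) `^ b)
    (a * beta_integrand a (b + 1) t - b * beta_integrand (a + 1) b t).
Proof.
move=> /andP[t0 t1].
have d1 := is_derive1_powR a t0.
have t1' : 0 < 1 - t by rewrite subr_gt0.
have d2 := is_derive1_powR b t1'.
have d3 : is_derive t 1 (fun t : R => 1 - t) (- 1).
  by apply: is_derive_eq; rewrite add0r mul1r.
have d4 := @is_derive1_comp _ (@powR R ^~ b) (fun t => 1 - t) _ _ _ d2 d3.
have := @is_deriveM _ _ _ _ _ _ _ _ d1 d4.
move=> h; apply: is_derive_eq; rewrite /GRing.scale/= /beta_integrand !addrK.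
ring.
Qed.

(** Integration by parts: t^a (1 - t)^b vanishes at both ends of the interval
because a and b are positive.  The exponents a - 1 and b - 1 may be negative,
so the fundamental theorem of calculus is applied on closed subintervals that
exhaust ]0, 1[. *)
Lemma betaE_parts a b : 0 < a -> 0 < b ->
  (a%:E * betaE a (b + 1) = b%:E * betaE (a + 1) b)%E.
Proof.
move=> a0 b0.
(* the shift by 3 makes d n < 1/2, so that no interval [d n, 1 - d n] is empty *)
pose d n : R := n.+3%:R^-1.
have d0 n : 0 < d n by rewrite invr_gt0.
have d12 n : d n < 1 / 2.
  by rewrite /d div1r ltf_pV2 ?posrE// ltr_nat.
have dlt n : d n < 1 - d n by have := d12 n; lra.
pose D n : set R := `[d n, 1 - d n]%classic.
have DE : \bigcup_n D n = `]0, 1[%classic.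
  apply/seteqP; split => t /=; last first.
    rewrite in_itv/= => /andP[t0 t1]; pose m := Num.min t (1 - t).
    have m0 : 0 < m by rewrite lt_min t0 subr_gt0.
    exists (Num.truncn m^-1) => //; rewrite /D/= in_itv/=.
    have : d (Num.truncn m^-1) <= m.
      rewrite -[leRHS]invrK lef_pV2 ?posrE ?invr_gt0//.
      by have := truncnS_gt m^-1; rewrite -[_.+3]addn2 natrD; lra.
    rewrite le_min; lra.
  by move=> [n _]; rewrite /D/= !in_itv/=; have := d0 n; lra.
have ndD : nondecreasing_seq D.
  move=> m n mn; apply/subsetPset => t; rewrite /D /= !in_itv/= => /andP[t1 t2].
  have : d n <= d m by rewrite lef_pV2 ?posrE// ler_nat.
  by move: t1 t2; lra.
have D01 n t : D n t -> 0 < t < 1.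
  by rewrite /D/= in_itv/=; have := d0 n; lra.
pose F t : R := t `^ a * (1 - t) `^ b.
pose f1 t := a * beta_integrand a (b + 1) t.
pose f2 t := b * beta_integrand (a + 1) b t.
have f10 t : 0 <= f1 t by rewrite mulr_ge0 ?beta_integrand_ge0// ltW.
have f20 t : 0 <= f2 t by rewrite mulr_ge0 ?beta_integrand_ge0// ltW.
have cpow (x c : R) : 0 < x -> {for x, continuous (fun y : R => y `^ c)}.
  move=> x0; apply/differentiable_continuous/derivable1_diffP.
  by apply: ex_derive; exact: is_derive1_powR.
have cbeta (c e t : R) : 0 < t < 1 -> {for t, continuous (beta_integrand c e)}.
  move=> /andP[t0 t1]; apply: cvgM; first exact: cpow.
  apply: (@continuous_comp _ _ _ (fun t : R => 1 - t) (fun y : R => y `^ (e - 1))).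
    by apply: cvgB; [exact: cvg_cst|exact: cvg_id].
  by apply: cpow; rewrite subr_gt0.
have cf (k c e : R) n : {within D n, continuous (fun t => k * beta_integrand c e t)}.
  apply: continuous_in_subspaceT => t; rewrite inE => /D01 tD.
  by apply: cvgM; [exact: cvg_cst|exact: cbeta].
have FTC n : (\int[mu1]_(t in D n) (f1 t)%:E + (F (d n))%:E
    = \int[mu1]_(t in D n) (f2 t)%:E + (F (1 - d n))%:E)%E.
  have if1 : mu1.-integrable (D n) (EFin \o f1).
    by apply: continuous_compact_integrable; [exact: segment_compact|exact: cf].
  have if2 : mu1.-integrable (D n) (EFin \o f2).
    by apply: continuous_compact_integrable; [exact: segment_compact|exact: cf].
  have cF t : 0 < t < 1 -> {for t, continuous F}.
    move=> t01; apply/differentiable_continuous/derivable1_diffP.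
    by apply: ex_derive; exact: beta_prod_derive.
  have mD : measurable (D n : set (measurableTypeR R)) by exact: measurable_itv.
  have fin1 := integrable_fin_num mD if1.
  have fin2 := integrable_fin_num mD if2.
  have gen (X Y : \bar R) (u v : R) : X \is a fin_num -> Y \is a fin_num ->
      (X - Y = u%:E - v%:E -> X + v%:E = Y + u%:E)%E.
    by case: X Y => [x| |] [y| |]// _ _ [e]; congr EFin; move: e; lra.
  apply: (gen _ _ _ _ fin1 fin2); rewrite -(integralB_EFin mD if1 if2).
  apply: (@continuous_FTC2 _ (fun t => f1 t - f2 t) F _ _ (dlt n)).
  - by move=> t; apply: cvgB; exact: cf.
  - split.
    + move=> t tI; apply: ex_derive; apply: beta_prod_derive.
      by apply: (D01 n); move: tI; rewrite /D/= !in_itv/= => /andP[/ltW -> /ltW ->].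
    + apply: cvg_at_right_filter; apply: cF; apply: (D01 n).
      by rewrite /D/= in_itv/= lexx ltW.
    + apply: cvg_at_left_filter; apply: cF; apply: (D01 n).
      by rewrite /D/= in_itv/= lexx ltW.
  - move=> t tI; rewrite derive1E; apply: derive_val; apply: beta_prod_derive.
    by apply: (D01 n); move: tI; rewrite /D/= !in_itv/= => /andP[/ltW -> /ltW ->].
have pow0 (c : R) : 0 < c -> (fun n => d n `^ c) @ \oo --> 0.
  move=> c0; have /cvg_at_rightP := powR_cvg0 c0; apply; split => //.
  exact: cvg_inv_shift3.
have powle1 (x c : R) : 0 < c -> 0 < x < 1 -> x `^ c <= 1.
  move=> c0 /andP[x0 x1]; rewrite -(powRr0 x); apply: ger_powR; last exact: ltW.
  by rewrite x0 ltW.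
have F0 : (fun n => (F (d n))%:E) @ \oo --> 0%E.
  apply: cvg_EFin; first by near=> n.
  apply: (@squeeze_cvgr _ _ _ _ (cst 0) (fun n => d n `^ a)); last 2 first.
  - exact: cvg_cst.
  - exact: pow0.
  near=> n; rewrite /F mulr_ge0 ?powR_ge0//= ler_piMr ?powR_ge0// powle1//.
  by have := d0 n; have := d12 n; lra.
have F1 : (fun n => (F (1 - d n))%:E) @ \oo --> 0%E.
  apply: cvg_EFin; first by near=> n.
  apply: (@squeeze_cvgr _ _ _ _ (cst 0) (fun n => d n `^ b)); last 2 first.
  - exact: cvg_cst.
  - exact: pow0.
  near=> n; rewrite /= /F subKr mulr_ge0 ?powR_ge0//= ler_piMl ?powR_ge0// powle1//.
  by have := d0 n; have := d12 n; lra.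
have L (k c e : R) : 0 < k ->
    (fun n => \int[mu1]_(t in D n) (k * beta_integrand c e t)%:E)%E @ \oo -->
    (k%:E * betaE c e)%E.
  move=> k0; rewrite /betaE -DE -ge0_integralZl_EFin//; last 4 first.
  - by apply: bigcup_measurable => n _; exact: measurable_itv.
  - by move=> t _; rewrite lee_fin beta_integrand_ge0.
  - by apply/measurable_EFinP/measurable_funTS; exact: measurable_beta_integrand.
  - exact: ltW.
  apply: ge0_nondecreasing_set_cvg_integral => //.
  - by move=> n; exact: measurable_itv.
  - move=> n; apply/measurable_EFinP/measurable_funTS.
    by apply: measurable_funM => //; exact: measurable_beta_integrand.
  - by move=> n t _; rewrite lee_fin mulr_ge0 ?beta_integrand_ge0// ltW.
have L1 := L a a (b + 1) a0.
have L2 := L b (a + 1) b b0.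
have fl : (0 : \bar R) \is a fin_num by [].
have A1 := cvgeD (fin_num_adde_defl _ fl) L1 F0.
have A2 := cvgeD (fin_num_adde_defl _ fl) L2 F1.
rewrite !adde0 in A1 A2.
have E1 := cvg_lim (@ereal_hausdorff R) (A1 _).
have E2 := cvg_lim (@ereal_hausdorff R) (A2 _).
rewrite -E1 -E2; congr (lim (_ @ \oo)); apply/funext => n; exact: FTC.
Unshelve. all: by end_near. Qed.

(** For exponents above 1 the integrand is bounded by 1; [betaE_parts] and
[betaE_split] then lower b, and next a, by one. *)
Lemma betaE_lty a b : 0 < a -> 0 < b -> (betaE a b < +oo)%E.
Proof.
move=> a0 b0.
have a10 : 0 < a + 1 by rewrite addr_gt0.
have mul_lty (k : R) (x : \bar R) : 0 < k -> (k%:E * x < +oo -> x < +oo)%E.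
  by case: x => [r| |] k0//; rewrite ?ltry// gt0_muley ?lte_fin.
have I11 : (betaE (a + 1) (b + 1) < +oo)%E.
  apply: (@le_lt_trans _ _ (\int[mu1]_(t in `]0%R, 1%R[) 1%:E)%E); last first.
    by rewrite integral_cst//= lebesgue_measure_itv/= lte_fin ltr01 mul1e sube0 ltry.
  apply: ge0_le_integral => //.
  - by move=> t _; rewrite lee_fin beta_integrand_ge0.
  - by apply/measurable_EFinP/measurable_funTS; exact: measurable_beta_integrand.
  - move=> t /=; rewrite in_itv/= => /andP[t0 t1]; rewrite lee_fin /beta_integrand.
    have le1 x c : 0 < c -> 0 < x -> x < 1 -> x `^ c <= 1.
      move=> c0 x0 x1; rewrite -(powRr0 x); apply: ger_powR; last exact: ltW.
      by rewrite x0 ltW.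
    by rewrite !addrK mulr_ile1 ?powR_ge0// le1// ?subr_gt0// ltrBlDr ltrDl.
have I10 : (betaE (a + 1) b < +oo)%E.
  rewrite betaE_split; apply: (lte_add_pinfty I11).
  apply: (mul_lty b _ b0); rewrite -(betaE_parts a10 b0).
  by apply: (@lte_mul_pinfty _ _ _ _ _ I11) => //; rewrite lee_fin ltW.
rewrite betaE_split; apply: (lte_add_pinfty _ I10).
apply: (mul_lty a _ a0); rewrite (betaE_parts a0 b0).
by apply: (@lte_mul_pinfty _ _ _ _ _ I10) => //; rewrite lee_fin ltW.
Qed.

Lemma betaE_fin a b : 0 < a -> 0 < b -> betaE a b = (Beta a b)%:E.
Proof.
move=> a0 b0; rewrite BetaE fineK// ge0_fin_numE; last exact: betaE_ge0.
exact: betaE_lty.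
Qed.

(** Eliminate Beta (a + 1) b between [betaE_split] and [betaE_parts]. *)
Lemma Beta_recr a b : 0 < a -> 0 < b ->
  Beta a (b + 1) * (a + b) = b * Beta a b.
Proof.
move=> a0 b0.
have a10 : 0 < a + 1 by rewrite addr_gt0.
have b10 : 0 < b + 1 by rewrite addr_gt0.
have := betaE_parts a0 b0; have := betaE_split a b.
rewrite (betaE_fin a0 b0) (betaE_fin a10 b0) (betaE_fin a0 b10) -EFinD -!EFinM.
move: (Beta _ _) (Beta _ _) (Beta _ _) => X Y Z [->] [E].
by rewrite mulrDr [b * _]mulrDr -E mulrC addrC [b * _]mulrC.
Qed.

Lemma Beta_gt0 a b : 0 < a -> 0 < b -> 0 < Beta a b.
Proof.
move=> a0 b0; rewrite lt_neqAle Beta_ge0 andbT eq_sym; apply/eqP => B0.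
have := betaE_fin a0 b0; rewrite B0 => I0.
have mI : measurable (`]0, 1[%classic : set (measurableTypeR R)).
  exact: measurable_itv.
have m01 : measurable_fun (`]0, 1[%classic : set (measurableTypeR R))
    (fun t => (beta_integrand a b t)%:E).
  by apply/measurable_EFinP/measurable_funTS; exact: measurable_beta_integrand.
have [+ _] := ae_eq_integral_abs mu1 mI m01.
have -> : (\int[mu1]_(x in `]0%R, 1%R[) `|(beta_integrand a b x)%:E| = 0)%E.
  rewrite -[RHS]I0; apply: eq_integral => t _.
  by rewrite gee0_abs// lee_fin beta_integrand_ge0.
move=> /(_ erefl)[N [mN N0 sN]].
have : (mu1 `]0%R, 1%R[%classic <= mu1 N)%E.
  apply: le_measure; rewrite ?inE// => t t01; apply: sN => /= /(_ t01)/eqP.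
  move: t01; rewrite /= in_itv/= => /andP[t0 t1].
  by rewrite gt_eqF// lte_fin mulr_gt0// powR_gt0// subr_gt0.
by rewrite N0 lebesgue_measure_itv/= lte_fin ltr01 sube0 lee_fin ler10.
Qed.

End beta.

(** * Integrals against mu *)

Section mu_integrals.
Variable R : realType.
Local Notation mu1 := (@lebesgue_measure R).
Local Notation lambda2 := (@lebesgue_measure R \x @lebesgue_measure R)%E.
Local Notation disk := (@disk R).
Implicit Types a b t : R.

Lemma ge0_integral_opp (f : R -> \bar R) :
  measurable_fun setT f -> (forall x, 0 <= f x)%E ->
  (\int[mu1]_x f (- x)%R = \int[mu1]_x f x)%E.
Proof.
move=> mf f0.
have mc : measurable_fun setT (fun x : measurableTypeR R => - x : measurableTypeR R).
  exact: measurable_funN.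
have := ge0_integral_pushforward mc mu1 measurableT mf (fun y _ => f0 y).
rewrite preimage_setT => <-.
by apply: eq_measure_integral => //= A mA _; exact: lebesgue_measureN.
Qed.

Lemma betaE_sym a b : betaE a b = betaE b a.
Proof.
rewrite /betaE integral_mkcond [RHS]integral_mkcond.
pose f t := ((fun t => (beta_integrand a b t)%:E) \_ `]0, 1[) t.
have mf : measurable_fun setT f.
  have mI : measurable (`]0, 1[%classic : set R) by exact: measurable_itv.
  apply/(measurable_restrictT _ mI).
  by apply/measurable_EFinP/measurable_funTS; exact: measurable_beta_integrand.
have f0 t : (0 <= f t)%E.
  by rewrite /f patchE; case: ifP => // _; rewrite lee_fin beta_integrand_ge0.
rewrite -(ge0_integral_shift 1 mf f0).
rewrite -(@ge0_integral_opp (fun t => f (t + 1))).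
- apply: eq_integral => t _; rewrite /f !patchE !mem_setE !in_itv/=.
  rewrite -[X in if X then _ else _](_ : (0 < t < 1) = (0 < - t + 1 < 1)).
    case: ifP => // _; rewrite /beta_integrand mulrC; congr (_ * _)%:E.
      by congr (_ `^ _); lra.
    by congr (_ `^ _); lra.
  by apply/idP/idP; lra.
- by apply: (measurableT_comp mf); exact: measurable_funD.
- by move=> t; exact: f0.
Qed.

Lemma absc_toC (u : R * R) : absc (toC u) = Num.sqrt (normsq u).
Proof. by []. Qed.

Lemma normsq_ge0 (u : R * R) : 0 <= normsq u.
Proof. by rewrite addr_ge0 ?sqr_ge0. Qed.

Lemma diskE (u : R * R) : disk u <-> normsq u < 1.
Proof.
case: u => x y; rewrite /Defs.disk /mkset absc_toC -[X in _ < X <-> _]sqrtr1.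
by rewrite ltr_sqrt.
Qed.

Lemma mu_densityE (alpha beta : R) (u : R * R) : disk u ->
  mu_density alpha beta u = normsq u `^ beta * (1 - normsq u) `^ alpha
    / Beta (alpha + 1) (beta + 1) / pi.
Proof.
move=> du; rewrite /mu_density patchE mem_set// absc_toC.
rewrite sqr_sqrtr ?normsq_ge0//; congr (_ * _ / _ / _).
by rewrite -powR12_sqrt ?normsq_ge0// -powRrM mulrA mulVf ?mul1r.
Qed.

Lemma ge0_integral_mu (alpha beta : R) (D : set (R * R)) (F : R * R -> \bar R) :
  measurable D -> measurable_fun D F -> (forall u, D u -> 0 <= F u)%E ->
  (\int[mu alpha beta]_(u in D) F u =
   \int[lambda2]_(u in D) (F u * (mu_density alpha beta u)%:E))%E.
Proof.
move=> mD mF F0.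
have mid : @measurable_fun _ _ (measurableTypeR R * measurableTypeR R)%type
  (R * R)%type setT id by exact: measurable_id.
pose m_ : {measure set (R * R)%type -> \bar R} :=
  pushforward lambda2 (id : measurableTypeR R * measurableTypeR R -> R * R).
have mg : measurable_fun setT (mu_density alpha beta).
  exact: measurable_mu_density.
rewrite (@ge0_integral_density _ (R * R)%type R (m_ mid) (mu alpha beta)
  (mu_density alpha beta))//.
- rewrite ge0_integral_pushforward//.
  + apply: emeasurable_funM => //.
    by apply/measurable_EFinP/measurable_funTS.
  + move=> u; rewrite inE => Du.
    by rewrite mule_ge0 ?F0// lee_fin mu_density_ge0.
- exact: mu_density_ge0.
- move=> A mA; rewrite ge0_integral_pushforward//.
  + by apply/measurable_EFinP/measurable_funTS.
  + by move=> u _; rewrite lee_fin mu_density_ge0.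
Qed.

Definition rotation (c s : R) (u : R * R) : R * R :=
  (c * u.1 - s * u.2, s * u.1 + c * u.2).

Lemma measurable_rotation c s : measurable_fun setT (rotation c s).
Proof.
by apply/measurable_fun_pair => /=; [apply: measurable_funB|apply: measurable_funD];
  apply: measurable_funM.
Qed.

Lemma normsq_rotation c s u : c ^+ 2 + s ^+ 2 = 1 ->
  normsq (rotation c s u) = normsq u.
Proof.
move=> cs; rewrite /normsq/rotation/= -[RHS]mul1r -cs; ring.
Qed.

Lemma measurable_fun_rotation d (T : sigmaRingType d) c s (g : R * R -> T) : c ^+ 2 + s ^+ 2 = 1 ->
  measurable_fun disk g -> measurable_fun disk (g \o rotation c s).
Proof.
move=> cs mg; apply: (measurable_comp (F := disk)) => //.
- exact: measurable_disk.
- by move=> _ /= [u du <-]; apply/diskE; rewrite normsq_rotation//; apply/diskE.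
- by apply: measurable_funTS; exact: measurable_rotation.
Qed.

Lemma disk_rotation c s u : c ^+ 2 + s ^+ 2 = 1 ->
  (rotation c s u \in disk) = (u \in disk).
Proof.
move=> cs; apply/idP/idP; rewrite !inE => /diskE d; apply/diskE; move: d.
  by rewrite normsq_rotation.
by rewrite normsq_rotation.
Qed.

Lemma mu_density_rotation (alpha beta c s : R) u : c ^+ 2 + s ^+ 2 = 1 ->
  mu_density alpha beta (rotation c s u) = mu_density alpha beta u.
Proof.
move=> cs; have [|] := boolP (u \in disk) => ud; last first.
  rewrite /mu_density !patchE (disk_rotation u cs) (negbTE ud); reflexivity.
have rd : rotation c s u \in disk by rewrite disk_rotation.
by rewrite inE in ud; rewrite inE in rd; rewrite !mu_densityE// normsq_rotation.
Qed.

(** The density depends on the modulus alone, so the invariance is that of Lebesgue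
measure, applied to the positive and the negative part. *)
Lemma integral_mu_rotation (alpha beta c s : R) (g : R * R -> \bar R) :
  c ^+ 2 + s ^+ 2 = 1 -> s != 0 -> measurable_fun disk g ->
  (\int[mu alpha beta]_(u in disk) g (rotation c s u) =
   \int[mu alpha beta]_(u in disk) g u)%E.
Proof.
move=> cs s0 mg.
suff H (h : R * R -> \bar R) : measurable_fun disk h -> (forall u, 0 <= h u)%E ->
    (\int[mu alpha beta]_(u in disk) h (rotation c s u) =
     \int[mu alpha beta]_(u in disk) h u)%E.
  rewrite integralE [RHS]integralE; congr (_ - _)%E.
    have HP := H (g^\+)%E (measurable_funepos mg) (funepos_ge0 g).
    by rewrite -HP; apply: eq_integral => u _; rewrite !funeposE.
  have HN := H (g^\-)%E (measurable_funeneg mg) (funeneg_ge0 g).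
  by rewrite -HN; apply: eq_integral => u _; rewrite !funenegE.
move=> mh h0.
have mdisk := @measurable_disk R.
rewrite ge0_integral_mu//; last exact: (@measurable_fun_rotation _ _ c s h cs).
rewrite ge0_integral_mu// integral_mkcond [RHS]integral_mkcond.
pose k := (fun u => h u * (mu_density alpha beta u)%:E)%E \_ disk.
have mk : measurable_fun setT k.
  apply/(measurable_restrictT _ mdisk); apply: emeasurable_funM => //.
  by apply/measurable_EFinP/measurable_funTS; exact: measurable_mu_density.
have k0 u : (0 <= k u)%E.
  rewrite /k patchE; case: ifP => // _.
  by rewrite mule_ge0// lee_fin mu_density_ge0.
transitivity (\int[lambda2]_u k u)%E; last by [].
rewrite -(ge0_integral_rotation cs s0 mk k0).
apply: eq_integral => u _; rewrite /k -/(rotation c s u) !patchE.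
rewrite (disk_rotation u cs) (mu_density_rotation alpha beta u cs); reflexivity.
Qed.

(** With t the squared radius, the density of mu is the integrand of
Beta (beta + 1, alpha + 1) up to a constant, and the factor pi from
[ge0_integral_radial] cancels the normalisation of the area measure. *)
Lemma ge0_integral_mu_radial (alpha beta : R) (h : R -> \bar R) :
  measurable_fun setT h -> (forall t, 0 <= h t)%E ->
  (\int[mu alpha beta]_(u in disk) h (normsq u) =
   ((Beta (alpha + 1) (beta + 1))^-1)%:E *
   \int[mu1]_(t in `]0%R, 1%R[) (h t * (beta_integrand (beta + 1) (alpha + 1) t)%:E))%E.
Proof.
move=> mh h0.
have mdisk := @measurable_disk R.
rewrite ge0_integral_mu//; last first.
  apply: measurable_funTS; apply: (measurableT_comp mh); exact: measurable_normsq.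
rewrite integral_mkcond.
pose B := (Beta (alpha + 1) (beta + 1))^-1.
have B0 : 0 <= B by rewrite invr_ge0 Beta_ge0.
have pi0 : 0 < pi :> R by exact: pi_gt0.
pose k t := ((pi^-1 * B)%:E * (h t * (beta_integrand (beta + 1) (alpha + 1) t)%:E))%E.
have k0 t : (0 <= k t)%E.
  have pB0 : 0 <= pi^-1 * B by rewrite mulr_ge0// invr_ge0 ltW.
  by rewrite /k !mule_ge0 ?lee_fin ?beta_integrand_ge0.
have mhb : measurable_fun setT (fun t => h t * (beta_integrand (beta + 1) (alpha + 1) t)%:E)%E.
  by apply: emeasurable_funM => //; apply/measurable_EFinP; exact: measurable_beta_integrand.
have mk : measurable_fun setT k by apply: emeasurable_funM.
have mI1 : measurable (`]-oo, 1[%classic : set R) by exact: measurable_itv.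
pose k1 := k \_ `]-oo, 1[.
have k1E t : k1 t = if t < 1 then k t else 0%E.
  by rewrite /k1 patchE mem_setE in_itv.
have mk1 : measurable_fun setT k1.
  by apply/(measurable_restrictT _ mI1); exact: measurable_funTS.
have k10 t : (0 <= k1 t)%E by rewrite /k1 patchE; case: ifP.
transitivity (\int[lambda2]_u k1 (normsq u))%E.
  apply: eq_integral => u _; rewrite k1E patchE.
  case: ifPn; rewrite ?inE ?notin_setE => /diskE; last by move/negP/negbTE => ->.
  move=> u1; rewrite u1 mu_densityE; last exact/diskE.
  rewrite /k muleCA -EFinM; congr (_ * _%:E)%E.
  by rewrite /beta_integrand !addrK -/B; ring.
rewrite ge0_integral_radial//.
have mI0 : measurable (`[0, +oo[%classic : set (measurableTypeR R)) by exact: measurable_itv.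
transitivity (pi%:E * \int[mu1]_(t in `[0%R, 1%R[) k t)%E.
  congr (_ * _)%E; rewrite integral_mkcond [RHS]integral_mkcond.
  apply: eq_integral => t _; rewrite !patchE k1E !mem_setE !in_itv/= andbT.
  by case: (0 <= t); case: (t < 1).
rewrite -integral_itv_obnd_cbnd; last exact: measurable_funTS.
rewrite /k ge0_integralZl//; last 3 first.
- exact: measurable_funTS.
- by move=> t _; rewrite mule_ge0// lee_fin beta_integrand_ge0.
- by rewrite lee_fin mulr_ge0// invr_ge0 ltW.
by rewrite muleA -EFinM mulrA divff ?gt_eqF// mul1r.
Qed.

Lemma mu_moment (alpha beta s : R) : -1 < alpha -> -1 < beta -> -1 < beta + s ->
  (\int[mu alpha beta]_(u in disk) (normsq u `^ s)%:E =
   (Beta (alpha + 1) (beta + s + 1) / Beta (alpha + 1) (beta + 1))%:E)%E.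
Proof.
move=> a1 b1 bs1.
rewrite (@ge0_integral_mu_radial alpha beta (fun t => (t `^ s)%:E)); last 2 first.
- by apply/measurable_EFinP; exact: measurable_powR.
- by move=> t; rewrite lee_fin powR_ge0.
transitivity ((Beta (alpha + 1) (beta + 1))^-1%:E * betaE (beta + s + 1) (alpha + 1))%E.
  congr (_ * _)%E; apply: eq_integral => t; rewrite inE/= in_itv/= => /andP[t0 t1].
  rewrite -EFinM; congr EFin; rewrite /beta_integrand !addrK mulrA -powRD.
    by rewrite addrC.
  by rewrite (gt_eqF t0) implybT.
rewrite betaE_sym betaE_fin -?EFinM; first by rewrite mulrC.
  by rewrite -ltrBlDr sub0r.
by rewrite -ltrBlDr sub0r.
Qed.

(** The indicator of the origin is the indicator of t = 0 in the squared radius t,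
which is null for the radial formula. *)
Lemma mu_origin (alpha beta : R) : mu alpha beta [set (0, 0)] = 0%E.
Proof.
have mdisk := @measurable_disk R.
have m0 : measurable ([set 0] : set R) by [].
have := @ge0_integral_mu_radial alpha beta (fun t => (\1_[set 0] t)%:E).
have -> : (\int[mu1]_(t in `]0%R, 1%R[) ((\1_[set 0%R] t)%:E *
    (beta_integrand (beta + 1) (alpha + 1) t)%:E) = 0)%E.
  apply: integral0_eq => t; rewrite /= in_itv/= => /andP[t0 _].
  by rewrite indicE memNset ?mul0e// => /= t00; rewrite t00 ltxx in t0.
rewrite mule0 => <-.
- transitivity (\int[mu alpha beta]_(u in disk) (\1_[set (0%R, 0%R)] u)%:E)%E.
    rewrite integral_indic//; last first.
      rewrite (_ : [set (0, 0)] = [set 0] `*` [set 0]); first exact: measurableX.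
      by apply/seteqP; split => [u ->|[u1 u2] [/= -> ->]].
    rewrite setIidl// => _ ->; apply/diskE.
    by rewrite /normsq/= expr0n/= addr0 ltr01.
  apply: eq_integral => u _; rewrite !indicE; congr (_%:R%:E); congr nat_of_bool.
  apply/idP/idP; rewrite !inE/=; first by move=> ->;
    rewrite /normsq/= expr0n/= addr0.
  case: u => x y; rewrite /normsq/= => /eqP.
  by rewrite paddr_eq0 ?sqr_ge0// !sqrf_eq0 => /andP[/eqP -> /eqP ->].
- by apply/measurable_EFinP; exact: measurable_indic.
- by move=> t; rewrite lee_fin.
Qed.

(** The density is positive away from the origin, and a box has positive area. *)
Lemma mu_box_gt0 (alpha beta x1 x2 y1 y2 : R) : -1 < alpha -> -1 < beta ->
  x1 < y1 -> x2 < y2 ->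
  (forall u : R * R, x1 < u.1 < y1 -> x2 < u.2 < y2 -> disk u /\ u != (0, 0)) ->
  (0 < mu alpha beta (`]x1, y1[%classic `*` `]x2, y2[%classic))%E.
Proof.
move=> a1 b1 xy1 xy2 sub.
pose D : set (measurableTypeR R * measurableTypeR R) := `]x1, y1[%classic `*` `]x2, y2[%classic.
have mD : measurable D by apply: measurableX; exact: measurable_itv.
rewrite lt_neqAle; apply/andP; split; last exact: measure_ge0.
apply/eqP => /esym mu0.
have m01 : measurable_fun D (fun u => (mu_density alpha beta u)%:E).
  by apply/measurable_EFinP/measurable_funTS; exact: measurable_mu_density.
have [+ _] := ae_eq_integral_abs lambda2 mD m01.
have -> : (\int[lambda2]_(x in D) `|(mu_density alpha beta x)%:E| = 0)%E.
  rewrite -[RHS]mu0; apply: eq_integral => t _.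
  by rewrite gee0_abs// lee_fin mu_density_ge0.
move=> /(_ erefl)[N [mN N0 sN]].
have : (lambda2 D <= lambda2 N)%E.
  apply: le_measure; rewrite ?inE// => t Dt; apply: sN => /= /(_ Dt)/eqP.
  case: Dt; rewrite /= !in_itv/= => t1 t2; have [dt t0] := sub t t1 t2.
  apply/negP; rewrite gt_eqF// lte_fin mu_densityE//.
  have nt0 : 0 < normsq t.
    rewrite lt_neqAle normsq_ge0 andbT eq_sym paddr_eq0 ?sqr_ge0// !sqrf_eq0.
    by move: t0; case: (t : R * R) => v w; rewrite xpair_eqE.
  rewrite !mulr_gt0 ?powR_gt0 ?invr_gt0 ?pi_gt0//.
    by rewrite subr_gt0; apply/diskE.
  by rewrite Beta_gt0 // -ltrBlDr sub0r.
rewrite N0 product_measure1E; [|exact: measurable_itv..].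
have E1 : mu1 `]x1, y1[%classic = (y1 - x1)%:E.
  by rewrite lebesgue_measure_itv/= lte_fin xy1.
have E2 : mu1 `]x2, y2[%classic = (y2 - x2)%:E.
  by rewrite lebesgue_measure_itv/= lte_fin xy2.
suff : (mu1 `]x1, y1[%classic * mu1 `]x2, y2[%classic <= 0)%E -> False by [].
by rewrite E1 E2 -EFinM lee_fin leNgt mulr_gt0// subr_gt0.
Qed.

End mu_integrals.

(** * The modulus and complex derivatives *)

Section complex_abs.
Variable R : realType.
Local Notation C := R[i].
Implicit Types (z w : C) (x : R).

Lemma normcE_absc z : `|z| = (absc z)%:C.
Proof. by case: z. Qed.

Lemma absc_ge0 z : 0 <= absc z.
Proof. by case: z => a b; exact: sqrtr_ge0. Qed.

Lemma abscM z w : absc (z * w) = absc z * absc w.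
Proof. exact: ComplexField.Normc.normcM. Qed.

Lemma abscD z w : absc (z + w) <= absc z + absc w.
Proof. by have := ler_normD z w; rewrite !normcE_absc -rmorphD/= lecR. Qed.

Lemma abscN z : absc (- z) = absc z.
Proof. exact: normcN. Qed.

Lemma absc_real x : absc x%:C = `|x|.
Proof. by rewrite /absc/= expr0n/= addr0 sqrtr_sqr. Qed.

Lemma absc0 : absc (0 : C) = 0.
Proof. by rewrite absc_real normr0. Qed.

Lemma absc1 : absc (1 : C) = 1.
Proof. by rewrite absc_real normr1. Qed.

Lemma absc_eq0 z : (absc z == 0) = (z == 0).
Proof.
apply/eqP/eqP => [|->]; last exact: absc0.
exact: ComplexField.Normc.eq0_normc.
Qed.

Lemma absc_gt0 z : (0 < absc z) = (z != 0).
Proof. by rewrite lt_neqAle absc_ge0 andbT eq_sym absc_eq0. Qed.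

Lemma abscV z : absc z^-1 = (absc z)^-1.
Proof. exact: ComplexField.Normc.normcV. Qed.

Lemma abscX z n : absc (z ^+ n) = absc z ^+ n.
Proof. by elim: n => [|n IH]; rewrite ?absc1// !exprS abscM IH. Qed.

Lemma absc_conj z : absc z^* = absc z.
Proof. by case: z => a b; rewrite /absc/= sqrrN. Qed.

Lemma absc_sqr z : absc z ^+ 2 = complex.Re z ^+ 2 + complex.Im z ^+ 2.
Proof. by case: z => a b; rewrite /absc/= sqr_sqrtr// addr_ge0 ?sqr_ge0. Qed.

Lemma mulC_conj z : z * z^* = (absc z ^+ 2)%:C.
Proof.
by rewrite absc_sqr; case: z => a b; apply/eqP; rewrite eq_complex/=;
  apply/andP; split; apply/eqP; ring.
Qed.

Lemma ger_absc_Re z : `|complex.Re z| <= absc z.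
Proof.
by rewrite -(ler_pXn2r (n := 2)) ?nnegrE ?absc_ge0// absc_sqr real_normK ?num_real// lerDl sqr_ge0.
Qed.

Lemma ger_absc_Im z : `|complex.Im z| <= absc z.
Proof.
by rewrite -(ler_pXn2r (n := 2)) ?nnegrE ?absc_ge0// absc_sqr real_normK ?num_real// lerDr sqr_ge0.
Qed.

Lemma absc_le_ReIm z : absc z <= `|complex.Re z| + `|complex.Im z|.
Proof.
rewrite -(ler_pXn2r (n := 2)) ?nnegrE ?absc_ge0// ?addr_ge0// absc_sqr.
rewrite sqrrD !real_normK ?num_real// -addrA lerD2l lerDr.
by rewrite mulrn_wge0// mulr_ge0.
Qed.

Lemma abscB z w : absc (z - w) = absc (w - z).
Proof. by rewrite -abscN opprB. Qed.

Lemma absc_sub z w : absc z - absc w <= absc (z - w).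
Proof. by rewrite lerBlDr -{1}(subrK w z) abscD. Qed.

Lemma absc_exprz z (k : int) : absc (z ^ k) = absc z ^ k.
Proof. by case: k => n; rewrite ?NegzE -?exprnN ?exprnP ?abscV ?abscX// . Qed.

Lemma derivable_eps_cont (f : C -> C) z : derivable (f : C^o -> C^o) z 1 ->
  forall e : R, 0 < e -> exists2 d : R, 0 < d &
    forall w, absc (w - z) < d -> absc (f w - f z) < e.
Proof.
move=> /derivable1_diffP/differentiable_continuous/cvgrPdist_lt h e e0.
have e0' : 0 < e%:C :> C by rewrite ltcR.
have /nbhs_ballP[d /= d0 hd] := h _ e0'.
have dR : d = (complex.Re d)%:C.
  by apply/esym/RRe_real; exact: gtr0_real.
exists (complex.Re d); first by rewrite -ltcR -dR.
move=> w wz; have := hd w; rewrite normcE_absc ltcR abscB; apply.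
by rewrite /ball/= normcE_absc dR ltcR abscB.
Qed.

Lemma eps_derivable (f : C -> C) z (l : C) :
  (forall e : R, 0 < e -> exists2 d : R, 0 < d &
    forall h, h != 0 -> absc h < d -> absc (h^-1 * (f (z + h) - f z) - l) < e) ->
  derivable (f : C^o -> C^o) z 1.
Proof.
move=> H; apply/cvg_ex; exists l; apply/cvgrPdist_lt => e e0.
have eR : e = (complex.Re e)%:C by apply/esym/RRe_real; exact: gtr0_real.
have e0' : 0 < complex.Re e by rewrite -ltcR -eR.
have [d d0 Hd] := H _ e0'.
apply/nbhs_ballP; exists d%:C => /=; first by rewrite ltcR.
move=> h; rewrite /ball/= sub0r normrN normcE_absc ltcR => hd h0.
rewrite -normrN opprB normcE_absc eR ltcR.
have := Hd h h0 hd; congr (absc (_ - _) < _).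
by rewrite /GRing.scale/= mulr1 (addrC h).
Qed.

End complex_abs.

(** * Measurability on the punctured disk *)

Section complex_measurability.
Variable R : realType.
Local Notation C := R[i].
Local Notation disk := (@disk R).
Local Notation Dstar := (@Dstar R).
Implicit Types (z w : C) (u v : R * R) (f g : C -> C).

(** Such a set is the union of the boxes with rational centre and inverse integer
half-width that it contains, and these are countably many. *)
Lemma measurable_open_box (U : set (R * R)) :
  (forall u, U u -> exists2 e : R, 0 < e &
     forall v, `|v.1 - u.1| < e -> `|v.2 - u.2| < e -> U v) ->
  measurable U.
Proof.
move=> Uo.
pose box (q1 q2 : rat) (n : nat) : set (R * R) :=
  `]ratr q1 - n.+1%:R^-1, ratr q1 + n.+1%:R^-1[%classic `*`
  `]ratr q2 - n.+1%:R^-1, ratr q2 + n.+1%:R^-1[%classic.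
rewrite (_ : U = \bigcup_q1 \bigcup_q2 \bigcup_n
    (if `[< box q1 q2 n `<=` U >] then box q1 q2 n else set0)).
  apply: bigcupT_measurable_rat => q1; apply: bigcupT_measurable_rat => q2.
  apply: bigcupT_measurable => n; case: ifP => // _.
  by apply: measurableX; exact: measurable_itv.
apply/seteqP; split => [u Uu|u [q1 _] [q2 _] [n _]]; last first.
  by case: asboolP => // + bu; apply.
have [e e0 He] := Uo u Uu.
pose n := Num.truncn (2 / e).
have ne : 2 * n.+1%:R^-1 < e.
  have := truncnS_gt (2 / e); rewrite -/n => h.
  by rewrite ltr_pdivrMr// mulrC -ltr_pdivrMr.
have n0 : 0 < n.+1%:R^-1 :> R by rewrite invr_gt0.
have near (x : R) : exists q : rat, `|ratr q - x| < n.+1%:R^-1.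
  have xx : x - n.+1%:R^-1 < x + n.+1%:R^-1 by rewrite ltrBlDr -addrA ltrDl addr_gt0.
  have [q] := rat_in_itvoo xx.
  by rewrite in_itv/= => qI; exists q; rewrite ltr_distl.
have [q1 h1] := near u.1; have [q2 h2] := near u.2.
exists q1 => //; exists q2 => //; exists n => //.
have sub : box q1 q2 n `<=` U.
  move=> v; rewrite /box/= !in_itv/= => -[v1 v2].
  move: h1 h2; rewrite !ltr_distl => h1 h2.
  by apply: He; rewrite ltr_distl; move: ne n0 v1 v2 h1 h2;
    move: (n.+1%:R^-1 : R) => k; lra.
rewrite (asboolT sub) /box/= !in_itv/=.
by move: h1 h2; rewrite !ltr_distl; move: (n.+1%:R^-1 : R) => k h1 h2; split; lra.
Qed.

Lemma DstarP u : Dstar (toC u) <-> disk u /\ u <> (0, 0).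
Proof.
split => [/andP[u0 u1]|[u1 u0]].
  by split => // ue; move: u0; rewrite ue absc0 ltxx.
apply/andP; split => //; rewrite absc_gt0; apply/eqP; case: u u0 {u1} => x y u0 [x0 y0].
by apply: u0; rewrite x0 y0.
Qed.

Lemma Dstar_nbhs z : Dstar z -> exists2 d : R, 0 < d &
  forall w, absc (w - z) < d -> Dstar w.
Proof.
move=> /andP[z0 z1]; exists (Num.min (absc z) (1 - absc z)).
  by rewrite lt_min z0 subr_gt0.
move=> w; rewrite lt_min => /andP[d1 d2].
have := absc_sub z w; have := absc_sub w z; rewrite (abscB z w).
by move=> e1 e2; apply/andP; split; lra.
Qed.

(** Continuity is required at the points of the punctured disk only; a superlevel
set is an open set together with at most the origin. *)
Lemma measurable_fun_cont_box (g : R * R -> R) :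
  (forall u, Dstar (toC u) -> forall e : R, 0 < e -> exists2 d : R, 0 < d &
     forall v, `|v.1 - u.1| < d -> `|v.2 - u.2| < d -> `|g v - g u| < e) ->
  measurable_fun disk g.
Proof.
move=> gc; apply: (measurability _ (RGenOInfty.measurableE R)) => _ [_ [x ->] <-].
rewrite (_ : _ `&` _ = [set u | Dstar (toC u) /\ x < g u] `|`
   (if x < g (0, 0) then [set (0, 0)] else set0)); last first.
  apply/seteqP; split => u /=.
    rewrite in_itv/= andbT => -[du xg]; have [u0|u0] := pselect (u = (0, 0)).
      by right; rewrite -u0 xg.
    by left; split => //; apply/DstarP.
  rewrite in_itv/= andbT => -[[/DstarP[]]|]//.
  case: ifP => // xg ->; split => //; apply/diskE.
  by rewrite /normsq/= expr0n/= addr0 ltr01.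
apply: measurableU; last first.
  case: ifP => // _; rewrite (_ : [set (0, 0)] = [set 0] `*` [set 0]).
    by apply: measurableX.
  by apply/seteqP; split => [u ->|[u1 u2] [/= -> ->]].
apply: measurable_open_box => u [Du xg].
have [d1 d10 h1] : exists2 e : R, 0 < e &
    forall v, `|v.1 - u.1| < e -> `|v.2 - u.2| < e -> Dstar (toC v).
  have [m m0 hm] := Dstar_nbhs Du.
  exists (m / 2); first by rewrite divr_gt0.
  move=> v v1 v2; apply: hm; rewrite (le_lt_trans (absc_le_ReIm _))// (splitr m).
  have -> : toC v - toC u = toC (v.1 - u.1, v.2 - u.2) by [].
  exact: ltrD.
have [d2 d20 h2] := gc u Du (g u - x) ltac:(lra).
exists (Num.min d1 d2); first by rewrite lt_min d10.
move=> v; rewrite !lt_min => /andP[v11 v12] /andP[v21 v22]; split; first exact: h1.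
by have := h2 v v12 v22; rewrite ltr_distl; lra.
Qed.

Definition Cmeasurable f :=
  measurable_fun disk (fun u => complex.Re (f (toC u))) /\
  measurable_fun disk (fun u => complex.Im (f (toC u))).

Lemma eps_cont_Cmeasurable f :
  (forall z, Dstar z -> forall e : R, 0 < e -> exists2 d : R, 0 < d &
    forall w, absc (w - z) < d -> absc (f w - f z) < e) -> Cmeasurable f.
Proof.
move=> fc; split; apply: measurable_fun_cont_box => u Du e e0;
  have [d d0 h] := fc _ Du e e0; (exists (d / 2); first by rewrite divr_gt0) => v v1 v2;
  have {}h : absc (f (toC v) - f (toC u)) < e.
- apply: h; rewrite (le_lt_trans (absc_le_ReIm _))// (splitr d); exact: ltrD.
- by rewrite -raddfB (le_lt_trans (ger_absc_Re _)).
- apply: h; rewrite (le_lt_trans (absc_le_ReIm _))// (splitr d); exact: ltrD.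
- by rewrite -raddfB (le_lt_trans (ger_absc_Im _)).
Qed.

Lemma holomorphic_Cmeasurable f : holomorphic_on Dstar f -> Cmeasurable f.
Proof.
by move=> hf; apply: eps_cont_Cmeasurable => z Dz; apply: derivable_eps_cont; exact: hf.
Qed.

Lemma CmeasurableM f g : Cmeasurable f -> Cmeasurable g ->
  Cmeasurable (fun z => f z * g z).
Proof.
move=> [f1 f2] [g1 g2]; split.
  rewrite (_ : (fun u => _) = fun u => complex.Re (f (toC u)) * complex.Re (g (toC u)) -
    complex.Im (f (toC u)) * complex.Im (g (toC u))).
    by apply: measurable_funB; apply: measurable_funM.
  by apply/funext => u; case: (f _) => a b; case: (g _).
rewrite (_ : (fun u => _) = fun u => complex.Re (f (toC u)) * complex.Im (g (toC u)) +
  complex.Im (f (toC u)) * complex.Re (g (toC u))).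
  by apply: measurable_funD; apply: measurable_funM.
by apply/funext => u; case: (f _) => a b; case: (g _).
Qed.

Lemma CmeasurableD f g : Cmeasurable f -> Cmeasurable g ->
  Cmeasurable (fun z => f z + g z).
Proof.
move=> [f1 f2] [g1 g2]; split.
  rewrite (_ : (fun u => _) = fun u => complex.Re (f (toC u)) + complex.Re (g (toC u))).
    exact: measurable_funD.
  by apply/funext => u; rewrite raddfD.
rewrite (_ : (fun u => _) = fun u => complex.Im (f (toC u)) + complex.Im (g (toC u))).
  exact: measurable_funD.
by apply/funext => u; rewrite raddfD.
Qed.

Lemma Cmeasurable_cst (c : C) : Cmeasurable (fun=> c).
Proof. by split; exact: measurable_cst. Qed.

Lemma Cmeasurable_conj f : Cmeasurable f -> Cmeasurable (fun z => (f z)^*).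
Proof.
move=> [f1 f2]; split.
  rewrite (_ : (fun u => _) = fun u => complex.Re (f (toC u)))//.
  by apply/funext => u; case: (f _).
rewrite (_ : (fun u => _) = fun u => - complex.Im (f (toC u))).
  exact: measurable_funN.
by apply/funext => u; case: (f _).
Qed.

Lemma Cmeasurable_absc2 f : Cmeasurable f ->
  measurable_fun disk (fun u => absc (f (toC u)) ^+ 2).
Proof.
move=> [f1 f2]; under eq_fun do rewrite absc_sqr.
by apply: measurable_funD; apply: measurable_funX.
Qed.

Lemma eq_holomorphic f g : (forall z, Dstar z -> f z = g z) ->
  holomorphic_on Dstar f -> holomorphic_on Dstar g.
Proof.
move=> fg hf z Dz; apply: (near_eq_derivable (f := (f : C^o -> C^o))); last exact: hf.
have [m m0 hm] := Dstar_nbhs Dz.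
apply/nbhs_ballP; exists m%:C => /=; first by rewrite ltcR.
by move=> w; rewrite /ball/= normcE_absc ltcR abscB => /hm; exact: fg.
Qed.

End complex_measurability.

(** * The space of square-integrable functions *)

Section L2_space.
Variables (R : realType) (alpha beta : R).
Local Notation C := R[i].
Local Notation disk := (@disk R).
Local Notation Dstar := (@Dstar R).
Local Notation Re := complex.Re.
Local Notation Im := complex.Im.
Local Notation m := (mu alpha beta).
Local Notation dot := (@L2dot R alpha beta).
Local Notation CI := (@Cintegral R alpha beta).
Local Notation Cint := (@Cintegrable R alpha beta).
Implicit Types (f g h F G : C -> C) (z w : C).

Lemma conj_realC (x : R) : x%:C^* = x%:C.
Proof. by apply/eqP; rewrite eq_complex/= oppr0 !eqxx. Qed.

Lemma le_Cintegrable F (k : R * R -> R) : Cmeasurable F ->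
  m.-integrable disk (EFin \o k) -> (forall u, disk u -> absc (F (toC u)) <= k u) ->
  Cint F.
Proof.
move=> [mR mI] ik Fk; split.
- apply: (le_integrable (@measurable_disk R) _ _ ik); first exact/measurable_EFinP.
  move=> u du; rewrite /= lee_fin (le_trans (ger_absc_Re _))//.
  by rewrite (le_trans (Fk u du))// ler_norm.
- apply: (le_integrable (@measurable_disk R) _ _ ik); first exact/measurable_EFinP.
  move=> u du; rewrite /= lee_fin (le_trans (ger_absc_Im _))//.
  by rewrite (le_trans (Fk u du))// ler_norm.
Qed.

Lemma CintegralD F G : Cint F -> Cint G -> CI (fun z => F z + G z) = CI F + CI G.
Proof.
move=> [F1 F2] [G1 G2]; have mD := @measurable_disk R.
apply/eqP; rewrite eq_complex/= -!RintegralD//.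
apply/andP; split; apply/eqP; apply: eq_Rintegral => u _; exact: raddfD.
Qed.

Lemma CintegrableZ (c : C) F : Cint F -> Cint (fun z => c * F z).
Proof.
move=> [F1 F2]; have mD := @measurable_disk R; split.
  rewrite (_ : (fun u => _) = ((fun u => (Re c)%:E * (Re (F (toC u)))%:E) \-
      (fun u => (Im c)%:E * (Im (F (toC u)))%:E))%E).
    by apply: integrableB => //; exact: integrableZl.
  by apply/funext => u; case: c => a b; case: (F _) => x y.
rewrite (_ : (fun u => _) = ((fun u => (Re c)%:E * (Im (F (toC u)))%:E) \+
      (fun u => (Im c)%:E * (Re (F (toC u)))%:E))%E).
  by apply: integrableD => //; exact: integrableZl.
by apply/funext => u; case: c => a b; case: (F _) => x y.
Qed.

Lemma CintegralZ (c : C) F : Cint F -> CI (fun z => c * F z) = c * CI F.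
Proof.
move=> [F1 F2]; have mD := @measurable_disk R.
have iZ (k : R) (p : R * R -> R) : m.-integrable disk (EFin \o p) ->
    m.-integrable disk (EFin \o (fun u => k * p u)).
  move=> ip; rewrite (_ : EFin \o _ = (fun u => k%:E * (p u)%:E)%E)//.
  exact: integrableZl.
rewrite (_ : c * CI F = (Re c * Re (CI F) - Im c * Im (CI F)) +i*
   (Re c * Im (CI F) + Im c * Re (CI F))); last by case: c.
apply/eqP; rewrite eq_complex/= -!RintegralZl// -RintegralB ?iZ// -RintegralD ?iZ//.
apply/andP; split; apply/eqP; apply: eq_Rintegral => u _.
  by case: c => a b; case: (F _).
by case: c => a b; case: (F _).
Qed.

Lemma Cintegral_conj F : Cint F -> CI (fun z => (F z)^*) = (CI F)^*.
Proof.
move=> [F1 F2]; have mD := @measurable_disk R.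
apply/eqP; rewrite eq_complex/=; apply/andP; split; apply/eqP.
  by apply: eq_Rintegral => u _; case: (F _).
rewrite -[RHS]mulN1r -RintegralZl//; apply: eq_Rintegral => u _.
by rewrite mulN1r; case: (F _).
Qed.

Lemma ae_disk_Dstar : {ae m, forall u, disk u -> Dstar (toC u)}.
Proof.
exists [set (0, 0)]; split.
- rewrite (_ : [set (0, 0)] = [set 0] `*` [set 0]); first exact: measurableX.
  by apply/seteqP; split => [u ->|[u1 u2] [/= -> ->]].
- exact: mu_origin.
- move=> u /= h; apply: contrapT => u0; apply: h => du; exact/DstarP.
Qed.

Lemma eq_integral_Dstar (p k : R * R -> \bar R) :
  measurable_fun disk p -> measurable_fun disk k ->
  (forall u, Dstar (toC u) -> p u = k u) ->
  (\int[m]_(u in disk) p u = \int[m]_(u in disk) k u)%E.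
Proof.
move=> mp mk pk; apply: ae_eq_integral => //; first exact: measurable_disk.
by apply: filterS ae_disk_Dstar => u h /h; exact: pk.
Qed.

(** The origin is the only point of the disk outside [Dstar], and it is null. *)
Lemma eq_Cintegral F G : Cmeasurable F -> Cmeasurable G ->
  (forall z, Dstar z -> F z = G z) -> CI F = CI G.
Proof.
move=> [F1 F2] [G1 G2] FG; apply/eqP; rewrite eq_complex/=.
apply/andP; split; apply/eqP; congr fine; apply: eq_integral_Dstar.
- exact/measurable_EFinP.
- exact/measurable_EFinP.
- by move=> u Du; rewrite FG.
- exact/measurable_EFinP.
- exact/measurable_EFinP.
- by move=> u Du; rewrite FG.
Qed.

Definition L2 f := Cmeasurable f /\
  m.-integrable disk (fun u => (absc (f (toC u)) ^+ 2)%:E).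

Lemma L2_dot f g : L2 f -> L2 g -> Cint (fun z => f z * (g z)^*).
Proof.
move=> [mf If] [mg Ig].
apply: (@le_Cintegrable _ (fun u => absc (f (toC u)) ^+ 2 + absc (g (toC u)) ^+ 2)).
- by apply: CmeasurableM => //; exact: Cmeasurable_conj.
- exact: (integrableD (@measurable_disk R) If Ig).
- move=> u _; rewrite abscM absc_conj.
  have := sqr_ge0 (absc (f (toC u)) - absc (g (toC u))).
  have := absc_ge0 (f (toC u)); have := absc_ge0 (g (toC u)).
  move: (absc (f _)) (absc (g _)) => x y; nra.
Qed.

Lemma L2D f g : L2 f -> L2 g -> L2 (fun z => f z + g z).
Proof.
move=> [mf If] [mg Ig]; have mD := @measurable_disk R.
have mfg := CmeasurableD mf mg; split => //.
have I2 : m.-integrable disk (fun u =>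
    (2%:E * ((absc (f (toC u)) ^+ 2)%:E + (absc (g (toC u)) ^+ 2)%:E))%E).
  by apply: integrableZl => //; exact: integrableD.
apply: (le_integrable mD _ _ I2).
  by apply/measurable_EFinP; exact: (Cmeasurable_absc2 mfg).
move=> u _; rewrite -EFinD -EFinM lee_fin.
rewrite ger0_norm ?sqr_ge0// ger0_norm ?mulr_ge0 ?addr_ge0 ?sqr_ge0//.
have := abscD (f (toC u)) (g (toC u)); have := absc_ge0 (f (toC u) + g (toC u)).
move: (absc (f _ + _)) (absc (f _)) (absc (g _)) => s x y s0 sxy.
have := sqr_ge0 (x - y); nra.
Qed.

Lemma L2Z (c : C) f : L2 f -> L2 (fun z => c * f z).
Proof.
move=> [mf If]; split; first by apply: CmeasurableM => //; exact: Cmeasurable_cst.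
rewrite (_ : (fun u => _) = (fun u => ((absc c ^+ 2)%:E * (absc (f (toC u)) ^+ 2)%:E)%E)).
  by apply: integrableZl => //; exact: measurable_disk.
by apply/funext => u; rewrite abscM exprMn EFinM.
Qed.

Lemma L2B f g : L2 f -> L2 g -> L2 (fun z => f z - g z).
Proof.
move=> Lf Lg; rewrite (_ : (fun z => _) = (fun z => f z + (-1) * g z)).
  by apply: L2D => //; exact: L2Z.
by apply/funext => z; rewrite mulN1r.
Qed.

Lemma L2_0 : L2 (fun=> 0).
Proof.
split; first exact: Cmeasurable_cst.
under eq_fun do rewrite absc0 expr0n/=.
exact: integrable0.
Qed.

Lemma eq_L2 f g : Cmeasurable g -> (forall z, Dstar z -> f z = g z) -> L2 f -> L2 g.
Proof.
move=> mg fg [mf If]; split => //.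
have mf2 : measurable_fun disk (fun u => (absc (f (toC u)) ^+ 2)%:E).
  by apply/measurable_EFinP; exact: Cmeasurable_absc2.
have mg2 : measurable_fun disk (fun u => (absc (g (toC u)) ^+ 2)%:E).
  by apply/measurable_EFinP; exact: Cmeasurable_absc2.
apply/integrableP; split => //.
move/integrableP : If => [_]; congr (_ < _)%E; apply: eq_integral_Dstar.
- exact: measurableT_comp.
- exact: measurableT_comp.
- by move=> u Du; rewrite fg.
Qed.

Lemma A2_L2 f : A2 alpha beta f -> L2 f.
Proof. by move=> [hf If]; split => //; exact: holomorphic_Cmeasurable. Qed.

Lemma L2_A2 f : holomorphic_on Dstar f -> L2 f -> A2 alpha beta f.
Proof. by move=> hf [_ If]; split. Qed.

Lemma dotDl f g h : L2 f -> L2 g -> L2 h ->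
  dot (fun z => f z + g z) h = dot f h + dot g h.
Proof.
move=> Lf Lg Lh; rewrite /L2dot -CintegralD; [|exact: L2_dot|exact: L2_dot].
by congr (CI _); apply/funext => z; rewrite mulrDl.
Qed.

Lemma dotZl (c : C) f h : L2 f -> L2 h -> dot (fun z => c * f z) h = c * dot f h.
Proof.
move=> Lf Lh; rewrite /L2dot -CintegralZ; last exact: L2_dot.
by congr (CI _); apply/funext => z; rewrite mulrA.
Qed.

Lemma dot_conj f g : L2 f -> L2 g -> dot g f = (dot f g)^*.
Proof.
move=> Lf Lg; rewrite /L2dot -Cintegral_conj; last exact: L2_dot.
by congr (CI _); apply/funext => z; rewrite rmorphM/= conjCK mulrC.
Qed.

Lemma dotZr (c : C) f g : L2 f -> L2 g -> dot f (fun z => c * g z) = c^* * dot f g.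
Proof.
move=> Lf Lg; rewrite (dot_conj (L2Z c Lg) Lf) dotZl// rmorphM/=.
by rewrite -dot_conj.
Qed.

Lemma dotBl f g h : L2 f -> L2 g -> L2 h ->
  dot (fun z => f z - g z) h = dot f h - dot g h.
Proof.
move=> Lf Lg Lh; rewrite -mulN1r -dotZl// -dotDl//; last exact: L2Z.
by congr (CI _); apply/funext => z; rewrite mulN1r.
Qed.

Lemma dotBr f g h : L2 f -> L2 g -> L2 h ->
  dot f (fun z => g z - h z) = dot f g - dot f h.
Proof.
move=> Lf Lg Lh; rewrite (dot_conj (L2B Lg Lh) Lf) dotBl// rmorphB/=.
by rewrite -!dot_conj.
Qed.

Lemma dot0l h : L2 h -> dot (fun=> 0) h = 0.
Proof.
move=> Lh; rewrite -[RHS](mul0r (dot (fun=> 0) h)) -(dotZl 0 L2_0 Lh).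
by congr (CI _); apply/funext => z; rewrite !mul0r.
Qed.

Lemma dot_suml (n : nat) (F : nat -> C -> C) h : (forall k, L2 (F k)) -> L2 h ->
  L2 (fun z => \sum_(k < n) F k z) /\
  dot (fun z => \sum_(k < n) F k z) h = \sum_(k < n) dot (F k) h.
Proof.
move=> LF Lh; elim: n => [|n [IL IH]].
  rewrite big_ord0; under eq_fun do rewrite big_ord0; split; first exact: L2_0.
  exact: dot0l.
under eq_fun do rewrite big_ord_recr/=; split; first exact: L2D.
by rewrite dotDl// IH big_ord_recr.
Qed.

(** Fatou's lemma needs the squared norm in extended real form, before finiteness
is known. *)
Definition normE f : \bar R := (\int[m]_(u in disk) (absc (f (toC u)) ^+ 2)%:E)%E.

Definition norm2 f : R := Re (dot f f).

Lemma normE_ge0 f : (0 <= normE f)%E.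
Proof. by apply: integral_ge0 => u _; rewrite lee_fin sqr_ge0. Qed.

Lemma norm2_fine f : norm2 f = fine (normE f).
Proof.
rewrite /norm2 /L2dot/= /Rintegral; congr fine.
by apply: eq_integral => u _; rewrite mulC_conj.
Qed.

Lemma norm2E f : L2 f -> normE f = (norm2 f)%:E.
Proof.
move=> [mf If]; rewrite norm2_fine fineK//.
exact: (integrable_fin_num (@measurable_disk R) If).
Qed.

Lemma norm2_ge0 f : 0 <= norm2 f.
Proof. by rewrite norm2_fine fine_ge0// normE_ge0. Qed.

Lemma L2normE f : L2norm alpha beta f = Num.sqrt (norm2 f).
Proof. by []. Qed.

Lemma dot_norm2 f : L2 f -> dot f f = (norm2 f)%:C.
Proof.
move=> Lf; have := dot_conj Lf Lf; rewrite /norm2.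
case: (dot f f) => a b /= [ba]; congr (_ +i* _); lra.
Qed.

Lemma norm2B f g : L2 f -> L2 g ->
  norm2 (fun z => f z - g z) = norm2 f - 2 * Re (dot f g) + norm2 g.
Proof.
move=> Lf Lg; rewrite {1}/norm2 dotBl//; last exact: L2B.
rewrite !dotBr// (dot_conj Lf Lg) !dot_norm2//.
by case: (dot f g) => a b /=; ring.
Qed.

Lemma norm2Z (c : C) f : L2 f -> norm2 (fun z => c * f z) = absc c ^+ 2 * norm2 f.
Proof.
move=> Lf; rewrite {1}/norm2 dotZl ?dotZr//; last exact: L2Z.
by rewrite mulrA mulC_conj dot_norm2// -rmorphM.
Qed.

(** Expand the square of the norm of f - (x / M) g, with x the inner product.
The bound M in place of the norm of g spares the case where g vanishes. *)
Lemma cauchy_schwarz f g (M : R) : L2 f -> L2 g -> 0 < M -> norm2 g <= M ->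
  absc (dot f g) ^+ 2 <= M * norm2 f.
Proof.
move=> Lf Lg M0 gM; set x := dot f g.
have := norm2_ge0 (fun z => f z - (x / M%:C) * g z).
rewrite norm2B ?norm2Z//; last exact: L2Z.
rewrite dotZr// -/x abscM abscV absc_real (gtr0_norm M0).
have -> : Re ((x / M%:C)^* * x) = absc x ^+ 2 / M.
  have -> : x / M%:C = (M^-1)%:C * x by rewrite fmorphV mulrC.
  have M_neq0 : M != 0 by rewrite gt_eqF.
  by clearbody x; case: x => a b; rewrite absc_sqr /=; field.
rewrite exprMn exprVn => h.
have : absc x ^+ 2 / M ^+ 2 * norm2 g <= absc x ^+ 2 / M.
  have n1 : norm2 g / M <= 1 by rewrite ler_pdivrMr ?mul1r.
  have -> : absc x ^+ 2 / M ^+ 2 * norm2 g = absc x ^+ 2 / M * (norm2 g / M).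
    by field; rewrite gt_eqF.
  by rewrite ler_piMr// divr_ge0 ?sqr_ge0// ltW.
move=> h2; rewrite mulrC -ler_pdivrMr//; lra.
Qed.

Lemma eq_dot f g f' g' : L2 f -> L2 g -> Cmeasurable f' -> Cmeasurable g' ->
  (forall z, Dstar z -> f z = f' z) -> (forall z, Dstar z -> g z = g' z) ->
  dot f g = dot f' g'.
Proof.
move=> [mf _] [mg _] mf' mg' ff gg; apply: eq_Cintegral.
- by apply: CmeasurableM => //; exact: Cmeasurable_conj.
- by apply: CmeasurableM => //; exact: Cmeasurable_conj.
- by move=> z Dz; rewrite ff// gg.
Qed.

End L2_space.

(** * Subexponential sequences *)

Section subexponential.
Variable R : realType.
Implicit Types (a b : nat -> R) (r t rho : R).

(** Equivalently, the power series with coefficients a has radius of convergence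
at least 1.  Unlike polynomial growth, this class contains the quotients of
Pochhammer symbols by a simple ratio test, and it is closed under products and
square roots. *)
Definition subexp a := forall rho, 0 < rho < 1 ->
  exists K : R, forall n, `|a n| * rho ^+ n <= K.

Lemma sqrt_01 rho : 0 < rho < 1 -> 0 < Num.sqrt rho < 1.
Proof.
by move=> /andP[r0 r1]; rewrite sqrtr_gt0 r0/= -sqrtr1 ltr_sqrt.
Qed.

(** Give each factor the square root of rho. *)
Lemma subexpM a b : subexp a -> subexp b -> subexp (fun n => a n * b n).
Proof.
move=> ha hb rho r01; have /andP[r0 r1] := r01.
have s01 := sqrt_01 r01.
have [K hK] := ha _ s01; have [L hL] := hb _ s01.
exists (K * L) => n; rewrite normrM.
rewrite -{1}(sqr_sqrtr (ltW r0)) -exprM mulnC exprM expr2 mulrACA.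
by rewrite ler_pM ?mulr_ge0 ?exprn_ge0 ?sqrtr_ge0.
Qed.

Lemma subexp_le a b : (forall n, `|a n| <= `|b n|) -> subexp b -> subexp a.
Proof.
move=> ab hb rho r01; have [K hK] := hb _ r01; exists K => n.
have /andP[r0 _] := r01.
by rewrite (le_trans _ (hK n))// ler_wpM2r// exprn_ge0// ltW.
Qed.

Lemma subexp_bounded a (K : R) : (forall n, `|a n| <= K) -> subexp a.
Proof.
move=> h rho /andP[r0 r1]; exists K => n.
by rewrite (le_trans _ (h n))// ler_piMr// exprn_ile1// ltW.
Qed.

Lemma subexp_odd a : subexp a -> subexp (fun n => a (2 * n).+1).
Proof.
move=> ha rho r01; have /andP[r0 r1] := r01.
have s01 := sqrt_01 r01; have [K hK] := ha _ s01.
have s0 : 0 < Num.sqrt rho by case/andP: s01.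
exists (K / Num.sqrt rho) => n; rewrite ler_pdivlMr//.
apply: le_trans (hK (2 * n).+1); rewrite -mulrA ler_wpM2l//.
by rewrite exprSr exprM sqr_sqrtr// ltW.
Qed.

Lemma subexp_sqrt a : subexp a -> subexp (fun n => Num.sqrt (a n)).
Proof.
move=> ha rho r01; have /andP[r0 r1] := r01.
have r201 : 0 < rho ^+ 2 < 1.
  by rewrite exprn_gt0//= exprn_ilt1// ltW.
have [K hK] := ha _ r201; exists (Num.sqrt K) => n.
rewrite ger0_norm ?sqrtr_ge0//.
have rn0 : 0 <= rho ^+ n by rewrite exprn_ge0// ltW.
rewrite -[rho ^+ n](ger0_norm rn0) -sqrtr_sqr.
apply: (@le_trans _ _ (Num.sqrt `|a n| * Num.sqrt (rho ^+ n ^+ 2))).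
  by rewrite ler_wpM2r ?sqrtr_ge0// ler_wsqrtr// ler_norm.
by rewrite -sqrtrM// ler_wsqrtr// exprAC.
Qed.

Lemma subexp_ratio a : (forall n, 0 <= a n) ->
  (forall rho, 0 < rho < 1 -> exists N : nat, forall n, (N <= n)%N -> a n.+1 * rho <= a n) ->
  subexp a.
Proof.
move=> a0 h rho r01; have /andP[r0 r1] := r01; have [N hN] := h _ r01.
exists (\sum_(i < N.+1) a i * rho ^+ i) => n; rewrite ger0_norm//.
have t0 i : 0 <= a i * rho ^+ i by rewrite mulr_ge0// exprn_ge0// ltW.
have base k : (k <= N)%N -> a k * rho ^+ k <= \sum_(i < N.+1) a i * rho ^+ i.
  move=> kN; rewrite -ltnS in kN; rewrite (bigD1 (Ordinal kN))//= lerDl.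
  by apply: sumr_ge0.
elim: n => [|n IH]; first exact: base.
have [nN|Nn] := ltnP n N; first exact: base.
apply: le_trans IH; rewrite exprS mulrA ler_wpM2r ?exprn_ge0 ?(ltW r0)//.
exact: hN.
Qed.

Lemma pochhammerS (x : R) n : pochhammer x n.+1 = pochhammer x n * (x + n%:R).
Proof. by rewrite /pochhammer big_ord_recr. Qed.

Lemma pochhammer_gt0 (x : R) n : 0 < x -> 0 < pochhammer x n.
Proof. by move=> x0; apply: prodr_gt0 => i _; rewrite ltr_wpDr. Qed.

(** The ratio of consecutive terms is (x + n) / (y + n), which tends to 1. *)
Lemma subexp_pochhammer (x y : R) : 0 < x -> 0 < y ->
  subexp (fun n => pochhammer x n / pochhammer y n).
Proof.
move=> x0 y0; apply: subexp_ratio.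
  by move=> n; rewrite divr_ge0 ?ltW ?pochhammer_gt0.
(* beyond x / (1 - rho), rho (x + n) <= n, hence rho (x + n) <= y + n *)
move=> rho /andP[r0 r1]; exists (Num.truncn (x / (1 - rho))).+1 => n Nn.
have yn : 0 < y + n%:R by rewrite ltr_wpDr.
rewrite !pochhammerS invfM -!mulrA [X in _ <= X]mulrC [leRHS]mulrC ler_wpM2l//.
  by rewrite ltW ?pochhammer_gt0.
rewrite [leLHS]mulrCA -[leRHS]mulr1 ler_wpM2l//.
  by rewrite invr_ge0 ltW ?pochhammer_gt0.
rewrite [leLHS]mulrCA ler_pdivrMl// mulr1.
have : x / (1 - rho) <= n%:R.
  by rewrite (le_trans (ltW (truncnS_gt _)))// ler_nat.
rewrite ler_pdivrMr ?subr_gt0//; nra.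
Qed.

(** A special case of [subexp_pochhammer], as (2)_n / (1)_n = n + 1. *)
Lemma subexp_nat : subexp (fun n => n%:R).
Proof.
have h : subexp (fun n => pochhammer (2 : R) n / pochhammer 1 n).
  by apply: subexp_pochhammer.
apply: subexp_le h => n.
have E : pochhammer (2 : R) n = n.+1%:R * pochhammer 1 n.
  elim: n => [|n IH]; first by rewrite /pochhammer !big_ord0 mulr1.
  by rewrite !pochhammerS IH -![_ + n%:R]natrD; ring.
rewrite E mulfK ?gt_eqF ?pochhammer_gt0//.
by rewrite !ger0_norm// ler_nat.
Qed.

(** Choose rho strictly between r and 1; then t = r / rho. *)
Lemma subexp_geometric a r : subexp a -> 0 <= r < 1 ->
  exists K t : R, [/\ 0 <= K, 0 <= t < 1 & forall n, `|a n| * r ^+ n <= K * t ^+ n].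
Proof.
move=> ha /andP[r0 r1]; pose rho := (1 + r) / 2.
have rr : r < rho by rewrite /rho; lra.
have rho0 : 0 < rho by rewrite (le_lt_trans r0).
have rho1 : rho < 1 by rewrite /rho; lra.
have [K hK] := ha rho ltac:(by rewrite rho0 rho1).
exists K, (r / rho); split.
- by apply: le_trans (hK 0%N); rewrite expr0 mulr1.
- by rewrite divr_ge0 ?(ltW rho0)//= ltr_pdivrMr// mul1r.
- move=> n; rewrite expr_div_n mulrCA [leRHS]mulrC ler_wpM2r ?exprn_ge0//.
  by rewrite ler_pdivlMr ?exprn_gt0.
Qed.

End subexponential.

(** * Complex power series *)

Section complex_series.
Variable R : realType.
Local Notation C := R[i].
Local Notation Re := complex.Re.
Local Notation Im := complex.Im.
Implicit Types (z w h : C) (u v c : nat -> C) (K t r : R).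

Lemma geometric_tail (v : nat -> R) K t : 0 <= t < 1 ->
  (forall n, `|v n| <= K * t ^+ n) ->
  forall N, `|limn (series v) - \sum_(n < N) v n| <= K * t ^+ N / (1 - t).
Proof.
move=> /andP[t0 t1] hv N.
have K0 : 0 <= K by have := hv 0%N; rewrite mulr1; apply: le_trans.
have cv : cvgn (series v).
  apply: normed_cvg; apply: (@series_le_cvg _ _ (geometric K t)) => //.
  - by move=> n; exact: normr_ge0.
  - by move=> n; rewrite /geometric/= mulr_ge0// exprn_ge0.
  - by apply: is_cvg_geometric_series; rewrite ger0_norm.
have t10 : 1 - t != 0 by rewrite gt_eqF// subr_gt0.
have part k : `|\sum_(n < N + k) v n - \sum_(n < N) v n|
    <= K * t ^+ N * (1 - t ^+ k) / (1 - t).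
  elim: k => [|k IH]; first by rewrite addn0 !subrr normr0 mulr0 mul0r.
  rewrite addnS big_ord_recr/= addrAC (le_trans (ler_normD _ _))//.
  apply: le_trans (lerD IH (hv _)) _.
  by rewrite le_eqVlt; apply/orP; left; apply/eqP; rewrite exprD exprS; field.
have part' M : (N <= M)%N ->
    `|\sum_(n < M) v n - \sum_(n < N) v n| <= K * t ^+ N / (1 - t).
  move=> NM; have := part (M - N)%N; rewrite subnKC// => /le_trans; apply.
  rewrite ler_wpM2r ?invr_ge0 ?subr_ge0 ?(ltW t1)// ler_piMr//.
    by rewrite mulr_ge0// exprn_ge0.
  by rewrite gerBl exprn_ge0.
have : `|series v M - \sum_(n < N) v n| @[M --> \oo] -->
    `|limn (series v) - \sum_(n < N) v n|.
  apply: cvg_norm; apply: cvgB; [exact: cv|exact: cvg_cst].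
move=> h; rewrite -(cvg_lim (@Rhausdorff R) h); apply: limr_le.
  by apply/cvg_ex; eexists; exact: h.
near=> M.
rewrite /series/= big_mkord; apply: part'; near: M; exact: nbhs_infty_ge.
Unshelve. all: end_near. Qed.

(** Summing the real and imaginary parts separately reduces convergence to real
series. *)
Definition Csum u : C :=
  limn (series (fun n => Re (u n))) +i* limn (series (fun n => Im (u n))).

Lemma Csum_tail u K t : 0 <= t < 1 -> (forall n, absc (u n) <= K * t ^+ n) ->
  forall N, absc (Csum u - \sum_(n < N) u n) <= 2 * (K * t ^+ N / (1 - t)).
Proof.
move=> t01 hu N.
have hR n : `|Re (u n)| <= K * t ^+ n by rewrite (le_trans (ger_absc_Re _)).
have hI n : `|Im (u n)| <= K * t ^+ n by rewrite (le_trans (ger_absc_Im _)).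
apply: le_trans (absc_le_ReIm _) _; rewrite mulr2n mulrDl mul1r.
have -> : Re (Csum u - \sum_(n < N) u n) =
    limn (series (fun n => Re (u n))) - \sum_(n < N) Re (u n).
  by rewrite raddfB/= raddf_sum.
have -> : Im (Csum u - \sum_(n < N) u n) =
    limn (series (fun n => Im (u n))) - \sum_(n < N) Im (u n).
  by rewrite raddfB/= raddf_sum.
by apply: lerD; [exact: (geometric_tail t01 hR)|exact: (geometric_tail t01 hI)].
Qed.

Lemma Csum_bound u K t : 0 <= t < 1 -> (forall n, absc (u n) <= K * t ^+ n) ->
  absc (Csum u) <= 2 * (K / (1 - t)).
Proof.
by move=> t01 hu; have := Csum_tail t01 hu 0%N; rewrite big_ord0 subr0 mulr1.
Qed.

Definition geom_bounded u := exists K t, [/\ 0 <= K, 0 <= t < 1 & forall n, absc (u n) <= K * t ^+ n].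

(** Convergence of the partial sums, stated with the real-valued modulus; it agrees
with convergence in the topology of the complex numbers by [Cconv_cvg]. *)
Definition Cconv u (l : C) := forall e : R, 0 < e ->
  exists N : nat, forall n, (N <= n)%N -> absc (l - \sum_(k < n) u k) < e.

Lemma geom_tail_small K t (e : R) : 0 <= K -> 0 <= t < 1 -> 0 < e ->
  exists N : nat, forall n, (N <= n)%N -> 2 * (K * t ^+ n / (1 - t)) < e.
Proof.
move=> K0 /andP[t0 t1] e0.
have : (fun n => 2 * (K * t ^+ n / (1 - t))) @ \oo --> 2 * (K * 0 / (1 - t)).
  apply: cvgM; first exact: cvg_cst.
  apply: cvgM; last exact: cvg_cst.
  by apply: cvgM; [exact: cvg_cst|apply: cvg_expr; rewrite ger0_norm].
rewrite mulr0 mul0r mulr0 => /cvgrPdist_lt/(_ _ e0)[N _ hN].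
have p0 n : 0 <= 2 * (K * t ^+ n / (1 - t)).
  by rewrite mulr_ge0// divr_ge0 ?subr_ge0 ?(ltW t1)// mulr_ge0// exprn_ge0.
by exists N => n /hN; rewrite sub0r normrN (ger0_norm (p0 n)).
Qed.

Lemma geom_bounded_conv u : geom_bounded u -> Cconv u (Csum u).
Proof.
move=> [K [t [K0 t01 hu]]] e e0; have [N hN] := geom_tail_small K0 t01 e0.
by exists N => n /hN; apply: le_lt_trans; exact: Csum_tail.
Qed.

Lemma Cconv_unique u l1 l2 : Cconv u l1 -> Cconv u l2 -> l1 = l2.
Proof.
move=> h1 h2; apply/eqP; rewrite -subr_eq0 -absc_eq0 eq_le absc_ge0 andbT.
rewrite leNgt; apply/negP => e0; have e20 := divr_gt0 e0 (ltr0n R 2).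
have [N1 H1] := h1 _ e20; have [N2 H2] := h2 _ e20.
have := H1 _ (leq_maxl N1 N2); have := H2 _ (leq_maxr N1 N2).
set S := \sum_(_ < _) _ => a1 a2.
have := abscD (l1 - S) (S - l2); rewrite addrA subrK (abscB S l2); lra.
Qed.

Lemma CconvD u v l1 l2 : Cconv u l1 -> Cconv v l2 ->
  Cconv (fun n => u n + v n) (l1 + l2).
Proof.
move=> h1 h2 e e0; have e20 := divr_gt0 e0 (ltr0n R 2).
have [N1 H1] := h1 _ e20; have [N2 H2] := h2 _ e20.
exists (maxn N1 N2) => n; rewrite geq_max => /andP[/H1 a1 /H2 a2].
rewrite big_split/= opprD addrACA (splitr e).
by rewrite (le_lt_trans (abscD _ _))// ltrD.
Qed.

Lemma CconvZ (c : C) u l : Cconv u l -> Cconv (fun n => c * u n) (c * l).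
Proof.
move=> h e e0.
have c0 : 0 < absc c + 1 by rewrite ltr_wpDl ?absc_ge0.
have [N H] := h _ (divr_gt0 e0 c0).
exists N => n /H; rewrite -mulr_sumr -mulrBr abscM.
rewrite ltr_pdivlMr// => h1; apply: le_lt_trans h1.
by rewrite mulrC ler_wpM2l ?absc_ge0// lerDl.
Qed.

Lemma Cconv_cvg u l : Cconv u l -> (series (u : nat -> C^o) @ \oo --> (l : C^o)).
Proof.
move=> h; apply/cvgrPdist_lt => e e0.
have eR : e = (Re e)%:C by apply/esym/RRe_real; exact: gtr0_real.
have e0' : 0 < Re e by rewrite -ltcR -eR.
have [N hN] := h _ e0'.
exists N => // n /= /hN; rewrite /series/= big_mkord normcE_absc.
by rewrite eR ltcR.
Qed.

Lemma Cconv_lim u l : Cconv u l -> limn (series (u : nat -> C^o)) = l.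
Proof. by move=> /Cconv_cvg/cvg_lim; apply; exact: norm_hausdorff. Qed.

Lemma absc_natr n : absc (n%:R : C) = n%:R.
Proof. by rewrite -(rmorph_nat (real_complex R)) absc_real normr_nat. Qed.

(** The second-order Taylor remainder of the monomial of degree k, bounded
uniformly on the disk of radius r.  Dividing by r^2 keeps the exponents natural
when k < 2. *)
Lemma expr_diff1 z h r k : 0 < r -> absc z <= r -> absc (z + h) <= r ->
  absc ((z + h) ^+ k - z ^+ k - k%:R * h * z ^+ k.-1) <= absc h ^+ 2 * (k%:R ^+ 2 * r ^+ k / r ^+ 2).
Proof.
move=> r0 zr zhr; have r_neq0 : r != 0 by rewrite gt_eqF.
elim: k => [|k IH]; first by rewrite !expr0 subrr !mul0r subrr absc0 expr0n/= !mul0r mulr0.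
have -> : (z + h) ^+ k.+1 - z ^+ k.+1 - k.+1%:R * h * z ^+ k =
   (z + h) * ((z + h) ^+ k - z ^+ k - k%:R * h * z ^+ k.-1) + k%:R * h ^+ 2 * z ^+ k.-1.
  by case: k {IH} => [|k]; rewrite /= !exprS ?expr0; ring.
apply: le_trans (abscD _ _) _; rewrite !abscM !abscX absc_natr.
have E1 : absc (z + h) * absc ((z + h) ^+ k - z ^+ k - k%:R * h * z ^+ k.-1) <=
    r * (absc h ^+ 2 * (k%:R ^+ 2 * r ^+ k / r ^+ 2)).
  by apply: ler_pM => //; exact: absc_ge0.
have E2 : k%:R * absc h ^+ 2 * absc z ^+ k.-1 <= absc h ^+ 2 * (k%:R * r ^+ k / r).
  case: k {IH E1} => [|k]; first by rewrite !mul0r mulr0.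
  rewrite [leLHS]mulrAC mulrC -mulrA ler_wpM2l ?sqr_ge0//.
  by rewrite exprSr mulfK//= ler_wpM2l// lerXn2r// nnegrE ?absc_ge0// ltW.
apply: le_trans (lerD E1 E2) _.
have -> : r * (absc h ^+ 2 * (k%:R ^+ 2 * r ^+ k / r ^+ 2)) + absc h ^+ 2 * (k%:R * r ^+ k / r)
   = absc h ^+ 2 * ((k%:R ^+ 2 + k%:R) * r ^+ k.+1 / r ^+ 2).
  by rewrite [r ^+ k.+1]exprS; field.
rewrite ler_wpM2l ?sqr_ge0// ler_wpM2r ?invr_ge0 ?sqr_ge0// ler_wpM2r ?exprn_ge0 ?(ltW r0)//.
rewrite -[k.+1]addn1 natrD; have : 0 <= k%:R :> R by [].
move: (k%:R : R) => x; nra.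
Qed.

Definition Cpseries c z := Csum (fun n => c n * z ^+ n).

Lemma geom_bounded_pseries c z : subexp (fun n => absc (c n)) -> absc z < 1 ->
  geom_bounded (fun n => c n * z ^+ n).
Proof.
move=> hc z1; have [K [t [K0 t01 h]]] := subexp_geometric hc (r := absc z) ltac:(by rewrite absc_ge0 z1).
exists K, t; split => // n; rewrite abscM abscX.
by have := h n; rewrite ger0_norm ?absc_ge0.
Qed.

(** The candidate derivative is the term-by-term one.  By [expr_diff1] on a disk of
radius r < 1, the difference quotient minus this series is a series dominated
by |h| times a convergent geometric series, since the coefficients remain
subexponential after multiplication by n^2. *)
Lemma derivable_Cpseries c z : subexp (fun n => absc (c n)) -> absc z < 1 ->
  derivable (Cpseries c : C^o -> C^o) z 1.
Proof.
move=> hc z1; pose r := (1 + absc z) / 2.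
have z0 := absc_ge0 z.
have r0 : 0 < r by rewrite /r; lra.
have r1 : r < 1 by rewrite /r; lra.
have zr : absc z <= r by rewrite /r; lra.
pose d n := c n * n%:R * z ^+ n.-1.
have hc1 : subexp (fun n => absc (c n) * n%:R ^+ 2).
  rewrite (_ : (fun n => _) = fun n => absc (c n) * n%:R * n%:R).
    by apply: subexpM; [apply: subexpM => //|]; exact: subexp_nat.
  by apply/funext => n; rewrite expr2 mulrA.
have [K [t [K0 t01 hK]]] := subexp_geometric hc1 (r := r) ltac:(by rewrite ltW).
have ghK n : absc (c n) * n%:R ^+ 2 * r ^+ n <= K * t ^+ n.
  by have := hK n; rewrite ger0_norm// mulr_ge0 ?absc_ge0 ?sqr_ge0.
have gd : geom_bounded d.
  exists (K / r), t; split => //; first by rewrite divr_ge0// ltW.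
  move=> n; rewrite mulrAC ler_pdivlMr//; apply: le_trans (ghK n).
  rewrite /d !abscM absc_natr abscX; case: n => [|n]; first by rewrite mulr0n expr0n/= !(mulr0, mul0r).
  rewrite [r ^+ _]exprSr [leRHS]mulrA ler_wpM2r ?(ltW r0)//.
  apply: ler_pM => //.
  - by rewrite mulr_ge0 ?absc_ge0.
  - by rewrite exprn_ge0 ?absc_ge0.
  - by rewrite ler_wpM2l ?absc_ge0// expr2 ler_peMr// ler1n.
  - by rewrite lerXn2r// nnegrE ?absc_ge0// ltW.
pose M := 2 * (K / r ^+ 2 / (1 - t)).
have M0 : 0 <= M.
  by case/andP: t01 => _ t1; rewrite mulr_ge0// !divr_ge0 ?sqr_ge0// subr_ge0 ltW.
apply: (eps_derivable (l := Csum d)) => e e0.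
(* the first bound keeps z + h in the disk of radius r, the second gives |h| M < e *)
pose del := Num.min ((1 - absc z) / 2) (e / (M + 1)).
exists del; first by rewrite lt_min !divr_gt0 ?subr_gt0// ltr_wpDl.
move=> h h0; rewrite lt_min => /andP[h1 h2].
have zhr : absc (z + h) <= r.
  by rewrite (le_trans (abscD _ _))// /r; lra.
have zh1 : absc (z + h) < 1 by rewrite (le_lt_trans zhr).
have hpos : 0 < absc h by rewrite absc_gt0.
pose q n := h^-1 * (c n * (z + h) ^+ n + (-1) * (c n * z ^+ n)) + (-1) * d n.
have cq : Cconv q (h^-1 * (Cpseries c (z + h) - Cpseries c z) - Csum d).
  rewrite -[- Cpseries c z]mulN1r -[- Csum d]mulN1r.
  apply: CconvD; last by apply: CconvZ; exact: geom_bounded_conv.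
  apply: CconvZ; apply: CconvD; last apply: CconvZ;
    by apply: geom_bounded_conv; exact: geom_bounded_pseries.
have qb n : absc (q n) <= (absc h * (K / r ^+ 2)) * t ^+ n.
  have -> : q n = h^-1 * (c n * ((z + h) ^+ n - z ^+ n - n%:R * h * z ^+ n.-1)).
    rewrite /q /d; field; exact: h0.
  rewrite !abscM abscV ler_pdivrMl//.
  apply: le_trans (ler_wpM2l (absc_ge0 _) (expr_diff1 n r0 zr zhr)) _.
  have -> : absc (c n) * (absc h ^+ 2 * (n%:R ^+ 2 * r ^+ n / r ^+ 2)) =
    (absc h ^+ 2 / r ^+ 2) * (absc (c n) * n%:R ^+ 2 * r ^+ n) by ring.
  have -> : absc h * (absc h * (K / r ^+ 2) * t ^+ n) = (absc h ^+ 2 / r ^+ 2) * (K * t ^+ n) by ring.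
  by rewrite ler_wpM2l// divr_ge0 ?sqr_ge0.
have gq : geom_bounded q.
  exists (absc h * (K / r ^+ 2)), t; split => //.
  by rewrite mulr_ge0 ?absc_ge0// divr_ge0 ?sqr_ge0.
rewrite (Cconv_unique cq (geom_bounded_conv gq)).
apply: le_lt_trans (Csum_bound t01 qb) _.
have -> : 2 * (absc h * (K / r ^+ 2) / (1 - t)) = absc h * M by rewrite /M; ring.
move: h2; rewrite ltr_pdivlMr ?ltr_wpDl//; lra.
Qed.

End complex_series.

(** * Pointwise values and L2 limits *)

Section L2_convergence.
Variables (R : realType) (alpha beta : R).
Hypotheses (halpha : -1 < alpha) (hbeta : -1 < beta).
Local Notation C := R[i].
Local Notation disk := (@disk R).
Local Notation Dstar := (@Dstar R).
Local Notation m := (mu alpha beta).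
Local Notation L2 := (@L2 R alpha beta).
Local Notation dot := (@L2dot R alpha beta).
Local Notation normE := (@normE R alpha beta).
Local Notation norm2 := (@norm2 R alpha beta).
Implicit Types (f g h : C -> C) (z w : C).

(** If h were nonzero at z, it would stay above half of |h z| on a small box
around z by continuity, and such a box has positive measure. *)
Lemma norm0_eq0 h : holomorphic_on Dstar h -> normE h = 0%E ->
  forall z, Dstar z -> h z = 0.
Proof.
move=> hh h0 z Dz; apply/eqP; rewrite -absc_eq0 eq_le absc_ge0 andbT leNgt.
apply/negP => hz0.
have e0 : 0 < absc (h z) / 2 by rewrite divr_gt0.
have [d1 d10 H1] := derivable_eps_cont (hh _ Dz) e0.
have [d2 d20 H2] := Dstar_nbhs Dz.
pose d := Num.min d1 d2 / 2.
have d0 : 0 < d by rewrite divr_gt0// lt_min d10.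
pose x := complex.Re z; pose y := complex.Im z.
pose B : set (R * R) := `]x - d, x + d[%classic `*` `]y - d, y + d[%classic.
have Bd u : B u -> absc (toC u - z) < Num.min d1 d2.
  rewrite /B/= !in_itv/= => -[u1 u2]; rewrite (le_lt_trans (absc_le_ReIm _))//.
  rewrite (splitr (Num.min _ _)) -/d.
  have -> : complex.Re (toC u - z) = u.1 - x by rewrite raddfB.
  have -> : complex.Im (toC u - z) = u.2 - y by rewrite raddfB.
  by apply: ltrD; rewrite ltr_distl.
have BD u : B u -> Dstar (toC u).
  by move=> /Bd; rewrite lt_min => /andP[_]; exact: H2.
have Bh u : B u -> absc (h z) / 2 <= absc (h (toC u)).
  move=> /Bd; rewrite lt_min => /andP[/H1 a _].
  have := absc_sub (h z) (h (toC u)); rewrite abscB; lra.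
have mB : measurable B by apply: measurableX; exact: measurable_itv.
have mh := holomorphic_Cmeasurable hh.
have mh2 : measurable_fun disk (fun u => (absc (h (toC u)) ^+ 2)%:E).
  by apply/measurable_EFinP; exact: Cmeasurable_absc2.
have Bdisk : B `<=` disk by move=> u /BD/DstarP[].
have muB : (0 < m B)%E.
  apply: mu_box_gt0 => //; [lra|lra|move=> u u1 u2].
  have /BD/DstarP[du /eqP u0] : B u by rewrite /B/= !in_itv/=.
  by split.
have : (((absc (h z) / 2) ^+ 2)%:E * m B <= normE h)%E.
  rewrite -integral_cst//.
  apply: (@le_trans _ _ (\int[m]_(u in B) (absc (h (toC u)) ^+ 2)%:E)%E).
    apply: ge0_le_integral => //.
    - by move=> u _; rewrite lee_fin sqr_ge0.
    - exact: (measurable_funS (@measurable_disk R) Bdisk mh2).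
    - move=> u Bu; rewrite lee_fin lerXn2r ?nnegrE ?absc_ge0 ?(ltW e0)//.
      exact: Bh.
  apply: ge0_subset_integral => //; first exact: measurable_disk.
  by move=> u _; rewrite lee_fin sqr_ge0.
rewrite h0 leNgt => /negP; apply.
by rewrite mule_gt0// lte_fin exprn_gt0.
Qed.

(** Fatou's lemma for the squared moduli: pointwise convergence together with an
eventual bound on the norms bounds the norm of the limit. *)
Lemma fatou_norm f (g : nat -> C -> C) (B : R) : Cmeasurable f ->
  (forall n, Cmeasurable (g n)) ->
  (forall z, Dstar z -> forall e : R, 0 < e ->
    exists N : nat, forall n, (N <= n)%N -> absc (g n z - f z) < e) ->
  (exists N : nat, forall n, (N <= n)%N -> (normE (g n) <= B%:E)%E) ->
  (normE f <= B%:E)%E.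
Proof.
move=> mf mg gf [N gB].
have mD : measurable disk := @measurable_disk R.
pose p n (u : R * R) := (absc (g (n + N)%N (toC u)) ^+ 2)%:E.
have mp n : measurable_fun disk (p n).
  by apply/measurable_EFinP; exact: Cmeasurable_absc2.
have mlim : measurable_fun disk (fun u => limn_einf (p ^~ u)).
  rewrite /limn_einf; apply: measurableT_comp => //.
  apply: (@measurable_fun_limn_esup _ _ _ _ (fun n u => - p n u)%E) => n.
  exact: measurableT_comp.
have mf2 : measurable_fun disk (fun u => (absc (f (toC u)) ^+ 2)%:E).
  by apply/measurable_EFinP; exact: Cmeasurable_absc2.
have -> : normE f = (\int[m]_(u in disk) limn_einf (p ^~ u))%E.
  apply: eq_integral_Dstar => // u Du.
  have cv : p n u @[n --> \oo] --> (absc (f (toC u)) ^+ 2)%:E.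
    apply: cvg_EFin; first by near=> n.
    have ca : absc (g (n + N)%N (toC u)) @[n --> \oo] --> absc (f (toC u)).
      apply/cvgrPdist_lt => e e0; have [k hk] := gf _ Du _ e0.
      exists k => // n /= kn; have := hk (n + N)%N (leq_trans kn (leq_addr _ _)).
      apply: le_lt_trans; rewrite ler_norml.
      have := absc_sub (g (n + N)%N (toC u)) (f (toC u)).
      have := absc_sub (f (toC u)) (g (n + N)%N (toC u)).
      rewrite (abscB (f _)); lra.
    rewrite expr2; under eq_cvg do rewrite /= expr2.
    exact: cvgM.
  rewrite is_cvg_limn_einfE; last by apply/cvg_ex; eexists; exact: cv.
  by apply/esym/cvg_lim.
apply: le_trans (@fatou _ _ _ m disk mD p mp _) _.
  by move=> n u _; rewrite lee_fin sqr_ge0.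
rewrite limn_einf_lim; apply: lime_le; first exact: is_cvg_einfs.
near=> n; apply: (@le_trans _ _ (normE (g (n + N)%N))).
  by apply: ereal_inf_lbound; exists n => /=.
by apply: gB; rewrite leq_addl.
Unshelve. all: end_near. Qed.

End L2_convergence.

(** * Orthonormal sequences *)

Section orthonormal.
Variables (R : realType) (alpha beta : R).
Local Notation C := R[i].
Local Notation L2 := (@L2 R alpha beta).
Local Notation dot := (@L2dot R alpha beta).
Local Notation norm2 := (@norm2 R alpha beta).
Variable e : nat -> C -> C.
Hypothesis Le : forall n, L2 (e n).
Hypothesis ortho : forall n k, dot (e n) (e k) = (n == k)%:R.
Implicit Types (f g h : C -> C) (a b : nat -> C).

Definition psum_of a (N : nat) : C -> C := fun z => \sum_(n < N) a n * e n z.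

Lemma L2_psum a N : L2 (psum_of a N).
Proof.
have [] := @dot_suml R alpha beta N (fun n z => a n * e n z) (e 0%N) => //.
by move=> n; exact: L2Z.
Qed.

Lemma dot_psum a N h : L2 h -> dot (psum_of a N) h = \sum_(n < N) a n * dot (e n) h.
Proof.
move=> Lh; have [|_ ->] := @dot_suml R alpha beta N (fun n z => a n * e n z) h _ Lh.
  by move=> n; exact: L2Z.
by apply: eq_bigr => n _; rewrite dotZl.
Qed.

Lemma dot_psum_e a N k : dot (psum_of a N) (e k) = if (k < N)%N then a k else 0.
Proof.
rewrite dot_psum//; case: ifP => kN.
  rewrite (bigD1 (Ordinal kN))//= ortho eqxx mulr1 big1 ?addr0// => i ik.
  by rewrite ortho (_ : (i == k :> nat) = false) ?mulr0//; apply/negbTE.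
rewrite big1// => i _; rewrite ortho (_ : (i == k :> nat) = false) ?mulr0//.
by apply/negbTE; apply: contraFneq kN => <-.
Qed.

Lemma norm2_e n : norm2 (e n) = 1.
Proof. by rewrite /norm2 ortho eqxx. Qed.

(** The Pythagorean identity behind best approximation: the partial sum with the
coefficients of f is the closest one, and the last sum measures the defect of
any other choice.  It is proved by adding one term at a time. *)
Lemma bessel_id f a N : L2 f ->
  norm2 (fun z => f z - psum_of a N z) =
  norm2 f - \sum_(n < N) absc (dot f (e n)) ^+ 2 + \sum_(n < N) absc (a n - dot f (e n)) ^+ 2.
Proof.
move=> Lf; elim: N => [|N IH].
  rewrite !big_ord0 subr0 addr0; congr norm2.
  by apply/funext => z; rewrite /psum_of big_ord0 subr0.
have -> : (fun z => f z - psum_of a N.+1 z) =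
    (fun z => (f z - psum_of a N z) - a N * e N z).
  by apply/funext => z; rewrite /psum_of big_ord_recr/= opprD addrA.
have LS := L2_psum a N.
rewrite norm2B; [|exact: L2B|exact: L2Z].
rewrite norm2Z// norm2_e mulr1 IH dotZr//; last exact: L2B.
rewrite dotBl// dot_psum_e ltnn subr0.
set D := dot f; clearbody D; rewrite !big_ord_recr/=.
have -> : absc (a N - D (e N)) ^+ 2 = absc (a N) ^+ 2
    - 2 * complex.Re ((a N)^* * D (e N)) + absc (D (e N)) ^+ 2.
  by rewrite !absc_sqr; case: (a N) => x y; case: (D (e N)) => x' y' /=; ring.
ring.
Qed.

Lemma bessel f N : L2 f -> \sum_(n < N) absc (dot f (e n)) ^+ 2 <= norm2 f.
Proof.
move=> Lf; have := bessel_id (fun n => dot f (e n)) N Lf.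
rewrite [X in _ + X]big1 ?addr0; last by move=> i _; rewrite subrr absc0 expr0n.
by move=> h; rewrite -subr_ge0 -h norm2_ge0.
Qed.

Lemma norm2_psum a N : norm2 (psum_of a N) = \sum_(n < N) absc (a n) ^+ 2.
Proof.
have := bessel_id a N (L2_psum a N).
rewrite [X in _ + X]big1 ?addr0; last first.
  by move=> i _; rewrite dot_psum_e ltn_ord subrr absc0 expr0n.
have -> : norm2 (fun z => psum_of a N z - psum_of a N z) = 0.
  rewrite (_ : (fun z => _) = fun=> 0); last by apply/funext => z; rewrite subrr.
  by rewrite /norm2 dot0l//; exact: L2_0.
move=> /eqP; rewrite eq_sym subr_eq0 => /eqP ->.
by apply: eq_bigr => i _; rewrite dot_psum_e ltn_ord.
Qed.

Lemma norm2_psum_sub a N K : (N <= K)%N ->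
  norm2 (fun z => psum_of a K z - psum_of a N z) =
  \sum_(n < K) absc (a n) ^+ 2 - \sum_(n < N) absc (a n) ^+ 2.
Proof.
move=> NK; rewrite bessel_id ?norm2_psum; last exact: L2_psum.
rewrite [X in _ + X]big1 ?addr0; last first.
  move=> i _; rewrite dot_psum_e (leq_trans (ltn_ord i) NK) subrr absc0 expr0n//.
congr (_ - _); apply: eq_bigr => i _.
by rewrite dot_psum_e (leq_trans (ltn_ord i) NK).
Qed.

(** By [bessel_id] and [bessel], every |a n - <f, e n>|^2 is at most the squared
distance from f to the partial sums. *)
Lemma coef_unique f a : L2 f ->
  (forall eps : R, 0 < eps -> exists N0 : nat, forall N, (N0 <= N)%N ->
     norm2 (fun z => f z - psum_of a N z) < eps) ->
  forall n, dot f (e n) = a n.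
Proof.
move=> Lf H n; apply/eqP; rewrite -subr_eq0 -absc_eq0 abscB.
rewrite eq_le absc_ge0 andbT leNgt; apply/negP => d0.
have [N0 HN] := H _ (exprn_gt0 2 d0).
have := HN _ (leq_maxl N0 n.+1); rewrite bessel_id//.
have := bessel (maxn N0 n.+1) Lf.
have nN : (n < maxn N0 n.+1)%N by exact: leq_maxr.
rewrite [X in _ -> _ + X < _ -> _](bigD1 (Ordinal nN))//=.
have : 0 <= \sum_(i < maxn N0 n.+1 | i != Ordinal nN) absc (a i - dot f (e i)) ^+ 2.
  by apply: sumr_ge0 => i _; exact: sqr_ge0.
lra.
Qed.

End orthonormal.

(** * Rules of complex differentiation *)

Section complex_derivable.
Variable R : realType.
Local Notation C := R[i].
Implicit Types (f g : C -> C) (z : C).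

Lemma derivable_Cmul f g z : derivable (f : C^o -> C^o) z 1 ->
  derivable (g : C^o -> C^o) z 1 ->
  derivable ((fun w => f w * g w) : C^o -> C^o) z 1.
Proof. by move=> df dg; exact: (derivableM df dg). Qed.

Lemma derivable_Cinv f z : f z != 0 -> derivable (f : C^o -> C^o) z 1 ->
  derivable ((fun w => (f w)^-1) : C^o -> C^o) z 1.
Proof.
pose K : numFieldType := C.
by move=> f0 df; exact: (@derivableV K K^o (f : K^o -> K) z 1 f0 df).
Qed.

Lemma derivable_Ccomp f g z : derivable (f : C^o -> C^o) z 1 ->
  derivable (g : C^o -> C^o) (f z) 1 ->
  derivable ((fun w => g (f w)) : C^o -> C^o) z 1.
Proof.
pose K : numFieldType := C.
move=> /derivable1_diffP df /derivable1_diffP dg; apply/derivable1_diffP.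
exact: (@differentiable_comp K K^o K^o K^o f g z df dg).
Qed.

Lemma derivable_Cexp n z : derivable ((fun w => w ^+ n) : C^o -> C^o) z 1.
Proof. exact: (@exprn_derivable C n z 1). Qed.

End complex_derivable.

(** * Orthonormality of the monomials *)

Section basis.
Variables (R : realType) (alpha beta0 : R).
Hypotheses (halpha : -1 < alpha) (hbeta : -1 < beta0).
Local Notation C := R[i].
Local Notation disk := (@disk R).
Local Notation Dstar := (@Dstar R).
Local Notation gam := (gamma_coef alpha beta0).
Local Notation poch := (@pochhammer R).
Implicit Types (f g : C -> C) (z w : C) (p q n k : nat).

Lemma alpha1_gt0 : 0 < alpha + 1. Proof. by rewrite -ltrBlDr sub0r. Qed.

Lemma beta1_gt0 : 0 < beta0 + 1. Proof. by rewrite -ltrBlDr sub0r. Qed.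

Lemma ab2_gt0 : 0 < alpha + beta0 + 2.
Proof. by have := alpha1_gt0; have := beta1_gt0; lra. Qed.

Lemma betaDn_gtN1 p : -1 < beta0 + p%:R.
Proof. by rewrite ltr_wpDr. Qed.

(** Iterating [Beta_recr] multiplies the beta function by
(beta0 + n + 1) / (alpha + beta0 + n + 2) at each step. *)
Lemma Beta_pochhammer n : Beta (alpha + 1) (beta0 + n%:R + 1) =
  Beta (alpha + 1) (beta0 + 1) * (poch (beta0 + 1) n / poch (alpha + beta0 + 2) n).
Proof.
elim: n => [|n IH]; first by rewrite /pochhammer !big_ord0 addr0 divr1 mulr1.
have a0 := alpha1_gt0; have b0 := beta1_gt0; have ab0 := ab2_gt0.
have bn0 : 0 < beta0 + n%:R + 1 by rewrite -ltrBlDr sub0r betaDn_gtN1.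
pose X := alpha + 1 + (beta0 + n%:R + 1).
have XE : alpha + beta0 + 2 + n%:R = X by rewrite /X; ring.
have X0 : X != 0 by rewrite -XE gt_eqF// ltr_wpDr.
have P0 : poch (alpha + beta0 + 2) n != 0 by rewrite gt_eqF// pochhammer_gt0.
have := Beta_recr a0 bn0; rewrite -/X IH => E.
apply: (mulIf X0); rewrite !pochhammerS XE.
have -> : beta0 + n.+1%:R + 1 = beta0 + n%:R + 1 + 1 by rewrite -natr1; ring.
rewrite E; move: P0; move: (poch _ n) (poch _ n) (Beta _ _) => Q P B P0.
by clearbody X; field; rewrite X0.
Qed.

Lemma gam_sqr p n : gam p n ^+ 2 =
  poch (beta0 + 1) p / poch (alpha + beta0 + 2) p
  * (poch (alpha + beta0 + 2) n / poch (beta0 + 1) n).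
Proof.
rewrite sqr_sqrtr// mulr_ge0// divr_ge0// ltW// pochhammer_gt0//.
- exact: beta1_gt0.
- exact: ab2_gt0.
- exact: ab2_gt0.
- exact: beta1_gt0.
Qed.

Lemma gam_gt0 p n : 0 < gam p n.
Proof.
rewrite sqrtr_gt0 mulr_gt0// divr_gt0// pochhammer_gt0//.
- exact: beta1_gt0.
- exact: ab2_gt0.
- exact: ab2_gt0.
- exact: beta1_gt0.
Qed.

Lemma Dstar_neq0 z : Dstar z -> z != 0.
Proof. by case/andP; rewrite absc_gt0. Qed.

Lemma exprzB z n p : z != 0 -> z ^ (n%:Z - p%:Z) = z ^+ n / z ^+ p.
Proof. by move=> z0; rewrite expfzDr// -exprnN. Qed.

Lemma e_fun_holo p n : holomorphic_on Dstar (e_fun alpha beta0 p n).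
Proof.
apply: (@eq_holomorphic _ (fun z => (gam p n)%:C * (z ^+ n * (z ^+ p)^-1))).
  by move=> z Dz; rewrite /e_fun exprzB// Dstar_neq0.
move=> z Dz; apply: derivable_Cmul; first exact: derivable_cst.
apply: derivable_Cmul; first exact: derivable_Cexp.
apply: derivable_Cinv; last exact: derivable_Cexp.
by rewrite expf_neq0// Dstar_neq0.
Qed.

Lemma absc_e_fun2 p n (u : R * R) : Dstar (toC u) ->
  absc (e_fun alpha beta0 p n (toC u)) ^+ 2 =
  gam p n ^+ 2 * normsq u `^ (n%:R - p%:R).
Proof.
move=> Du; rewrite /e_fun abscM exprMn absc_real (gtr0_norm (gam_gt0 _ _)).
congr (_ * _); rewrite absc_exprz absc_toC.
have -> : n%:R - p%:R = (n%:Z - p%:Z)%:~R :> R by rewrite rmorphB.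
rewrite powR_intmul ?normsq_ge0// -[in RHS](sqr_sqrtr (normsq_ge0 u)).
by rewrite !exprnP !exprz_exp mulrC.
Qed.

(** The squared modulus is radial, so its integral is a moment of mu, a quotient of
beta functions; [gamma_coef] is the constant that makes it 1. *)
Lemma e_fun_L2 p n : L2 alpha (beta0 + p%:R) (e_fun alpha beta0 p n) /\
  norm2 alpha (beta0 + p%:R) (e_fun alpha beta0 p n) = 1.
Proof.
have me := holomorphic_Cmeasurable (@e_fun_holo p n).
have me2 : measurable_fun disk (fun u => (absc (e_fun alpha beta0 p n (toC u)) ^+ 2)%:E).
  by apply/measurable_EFinP; exact: Cmeasurable_absc2.
have mk : measurable_fun disk (fun u => (normsq u `^ (n%:R - p%:R))%:E).
  apply/measurable_EFinP; apply: measurable_funTS.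
  apply: (@measurableT_comp _ _ _ _ _ _ (@powR R ^~ (n%:R - p%:R))).
    exact: measurable_powR.
  exact: measurable_normsq.
have E1 : normE alpha (beta0 + p%:R) (e_fun alpha beta0 p n) = 1%E.
  transitivity (\int[mu alpha (beta0 + p%:R)]_(u in disk)
     ((gam p n ^+ 2)%:E * (normsq u `^ (n%:R - p%:R))%:E))%E.
    apply: eq_integral_Dstar => //; first exact: emeasurable_funM.
    by move=> u Du; rewrite absc_e_fun2.
  rewrite ge0_integralZl//; last 3 first.
  - exact: measurable_disk.
  - by move=> u _; rewrite lee_fin powR_ge0.
  - by rewrite lee_fin sqr_ge0.
  have bE : beta0 + p%:R + (n%:R - p%:R) = beta0 + n%:R by ring.
  rewrite mu_moment ?bE//; [|exact: betaDn_gtN1|exact: betaDn_gtN1].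
  rewrite !Beta_pochhammer gam_sqr -EFinM; congr EFin.
  have := Beta_gt0 alpha1_gt0 beta1_gt0.
  have := pochhammer_gt0 p ab2_gt0; have := pochhammer_gt0 n ab2_gt0.
  have := pochhammer_gt0 p beta1_gt0; have := pochhammer_gt0 n beta1_gt0.
  move: (poch _ _) (poch _ _) (poch _ _) (poch _ _) (Beta _ _) => a b c d e a0 b0 c0 d0 e0.
  by field; rewrite !gt_eqF.
have L : L2 alpha (beta0 + p%:R) (e_fun alpha beta0 p n).
  split => //; apply/integrableP; split => //.
  rewrite (_ : \int[_]_(x in _) _ = 1)%E ?ltry//.
  rewrite -E1; apply: eq_integral => u _.
  by rewrite gee0_abs// lee_fin sqr_ge0.
by split => //; apply: EFin_inj; rewrite -norm2E.
Qed.

Definition cis (t : R) : C := cos t +i* sin t.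

Lemma cisX t n : cis t ^+ n = cis (n%:R * t).
Proof.
elim: n => [|n IH]; first by rewrite mul0r /cis cos0 sin0.
rewrite exprS IH -natr1 mulrDl mul1r addrC /cis cosD sinD.
by apply/eqP; rewrite eq_complex/=; apply/andP; split; apply/eqP; ring.
Qed.

Lemma Cintegral_rotation (beta c s : R) (F : C -> C) :
  c ^+ 2 + s ^+ 2 = 1 -> s != 0 -> Cmeasurable F ->
  Cintegral alpha beta (fun z => F ((c +i* s) * z)) = Cintegral alpha beta F.
Proof.
move=> cs s0 [mR mI]; apply/eqP; rewrite eq_complex/=.
have rotE u : (c +i* s) * toC u = toC (rotation c s u).
  by apply/eqP; rewrite eq_complex/= [s * _ + _]addrC !eqxx.
apply/andP; split; apply/eqP; congr fine.
- rewrite -(@integral_mu_rotation _ alpha beta c s (fun u => (complex.Re (F (toC u)))%:E))//.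
    by apply: eq_integral => u _; rewrite rotE.
  exact/measurable_EFinP.
- rewrite -(@integral_mu_rotation _ alpha beta c s (fun u => (complex.Im (F (toC u)))%:E))//.
    by apply: eq_integral => u _; rewrite rotE.
  exact/measurable_EFinP.
Qed.

Lemma e_fun_rotation p n (t : R) z :
  e_fun alpha beta0 p n (cis t * z) = cis t ^ (n%:Z - p%:Z) * e_fun alpha beta0 p n z.
Proof. by rewrite /e_fun expfzMl mulrCA. Qed.

Lemma absc_cis (t : R) : absc (cis t) = 1.
Proof. by rewrite /absc/= cos2Dsin2 sqrtr1. Qed.

Lemma cis_conj (t : R) : cis t * (cis t)^* = 1.
Proof. by rewrite mulC_conj absc_sqr/= cos2Dsin2. Qed.

(** Rotating the variable by the angle t multiplies the integrand by
exp(i (n - k) t), while the integral does not change; so the integral is 0 as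
soon as this factor differs from 1. *)
Lemma e_fun_orthogonal p n k : (k < n)%N ->
  L2dot alpha (beta0 + p%:R) (e_fun alpha beta0 p n) (e_fun alpha beta0 p k) = 0.
Proof.
move=> kn.
have d0 : 0 < (n - k)%:R :> R by rewrite ltr0n subn_gt0.
(* with this angle the factor is i, and sin t <> 0 as [integral_mu_rotation] asks *)
pose t : R := pi / 2 / (n - k)%:R.
have s0 : sin t != 0.
  rewrite gt_eqF// sin_gt0_pi// !divr_gt0 ?pi_gt0//=.
  rewrite ltr_pdivrMr// ltr_pdivrMr// -mulrA ltr_pMr ?pi_gt0//.
  by rewrite -natrM ltr1n muln2 -addnn; case: (n - k)%N d0 => [|j]; rewrite ?ltxx// addSn addnS.
have cis0 : cis t != 0.
  by apply/eqP => c0; have := cis_conj t; rewrite c0 mul0r => /esym/eqP; rewrite oner_eq0.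
have cE : cis t ^ (n%:Z - p%:Z) * (cis t ^ (k%:Z - p%:Z))^* = 'i%C.
  have -> : cis t ^ (n%:Z - p%:Z) = cis t ^+ (n - k) * cis t ^ (k%:Z - p%:Z).
    by rewrite (exprzB n p cis0) (exprzB k p cis0) mulrA -exprD subnK ?(ltnW kn).
  rewrite -mulrA mulC_conj absc_exprz.
  have tE : (n - k)%:R * t = pi / 2 by rewrite /t mulrC divfK ?(gt_eqF d0).
  rewrite absc_cis exp1rz expr1n rmorph1 mulr1 cisX tE /cis cos_pihalf sin_pihalf.
  reflexivity.
have mF : Cmeasurable (fun z => e_fun alpha beta0 p n z * (e_fun alpha beta0 p k z)^*).
  apply: CmeasurableM; last apply: Cmeasurable_conj;
    by apply: holomorphic_Cmeasurable; exact: e_fun_holo.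
have H := @Cintegral_rotation (beta0 + p%:R) (cos t) (sin t) _ (cos2Dsin2 t) s0 mF.
have E : (fun z => e_fun alpha beta0 p n (cis t * z) * (e_fun alpha beta0 p k (cis t * z))^*) =
  (fun z => 'i%C * (e_fun alpha beta0 p n z * (e_fun alpha beta0 p k z)^*)).
  apply/funext => z; rewrite (e_fun_rotation p n t z) (e_fun_rotation p k t z).
  by rewrite (rmorphM Num.conj) mulrACA cE.
have Ln := (e_fun_L2 p n).1; have Lk := (e_fun_L2 p k).1.
set I := L2dot _ _ _ _; have : 'i%C * I = I.
  rewrite -[RHS]H -[RHS]/(Cintegral alpha (beta0 + p%:R) (fun z => e_fun alpha beta0 p n (cis t * z) * (e_fun alpha beta0 p k (cis t * z))^*)).
  rewrite E (CintegralZ 'i%C (L2_dot Ln Lk)); reflexivity.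
by case: I => a b /eqP; rewrite eq_complex/= => /andP[/eqP e1 /eqP e2];
  apply/eqP; rewrite eq_complex/=; apply/andP; split; apply/eqP; lra.
Qed.

(** Reindexing the odd monomials by n gives an orthonormal sequence, to which
Bessel's inequality applies. *)
Definition e_odd p n : C -> C := e_fun alpha beta0 p (2 * n).+1.

Lemma e_odd_L2 p n : L2 alpha (beta0 + p%:R) (e_odd p n).
Proof. exact: (e_fun_L2 _ _).1. Qed.

Lemma e_odd_orthonormal p n k :
  L2dot alpha (beta0 + p%:R) (e_odd p n) (e_odd p k) = (n == k)%:R.
Proof.
have [->|nk] := eqVneq n k.
  by rewrite dot_norm2 ?(e_fun_L2 _ _).2//; exact: e_odd_L2.
have [kn|kn] := ltnP k n.
  by apply: e_fun_orthogonal; rewrite ltnS ltn_mul2l.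
rewrite (dot_conj (e_odd_L2 p k) (e_odd_L2 p n)) [X in X^*]e_fun_orthogonal ?rmorph0//.
by rewrite ltnS ltn_mul2l/= ltn_neqAle nk.
Qed.

End basis.

(** * Square-summable expansions in the odd monomials *)

Section expansion.
Variables (R : realType) (alpha beta0 : R).
Hypotheses (halpha : -1 < alpha) (hbeta : -1 < beta0).
Local Notation C := R[i].
Local Notation Dstar := (@Dstar R).
Local Notation gam := (gamma_coef alpha beta0).
Local Notation e_odd := (e_odd alpha beta0).
Implicit Types (f g : C -> C) (z w : C) (p q n k N : nat) (b : nat -> C) (M eps : R).

Local Notation psum p := (psum_of (e_odd p)).
Local Notation nrm p := (norm2 alpha (beta0 + p%:R)).
Local Notation dotp p := (L2dot alpha (beta0 + p%:R)).
Local Notation L2p p := (L2 alpha (beta0 + p%:R)).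
Local Notation O2 := (O2 alpha beta0).

(** The bound M is explicit because [odd_series_tail] measures the tail of b by the
difference between such a bound and a partial sum. *)
Definition ell2 b M := forall N, \sum_(n < N) absc (b n) ^+ 2 <= M.

Lemma ell2_bounded b M : ell2 b M -> forall n, absc (b n) <= M + 1.
Proof.
move=> bM n; have := bM n.+1; rewrite big_ord_recr/=.
have : 0 <= \sum_(i < n) absc (b i) ^+ 2 by apply: sumr_ge0 => i _; exact: sqr_ge0.
have := absc_ge0 (b n); move: (absc (b n)) => x; nra.
Qed.

(** The sum of the squares is a supremum, so a partial sum comes within eps of it. *)
Lemma ell2_sharp b M eps : ell2 b M -> 0 < eps ->
  exists N0, ell2 b (\sum_(n < N0) absc (b n) ^+ 2 + eps).
Proof.
move=> bM e0; pose A : set R := [set \sum_(n < N) absc (b n) ^+ 2 | N in [set: nat]].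
have hA : has_sup A.
  split; first by exists (\sum_(n < 0) absc (b n) ^+ 2); exists 0%N.
  by exists M => _ [N _ <-].
have [_ [N0 _ <-] hN0] := sup_adherent e0 hA.
exists N0 => N; have : \sum_(n < N) absc (b n) ^+ 2 <= sup A.
  by apply: (sup_upper_bound hA); exists N.
lra.
Qed.

Lemma sum_sqr_mono b N K : (N <= K)%N ->
  \sum_(n < N) absc (b n) ^+ 2 <= \sum_(n < K) absc (b n) ^+ 2.
Proof.
move=> NK; rewrite -(subnKC NK); elim: (K - N)%N => [|k IH]; first by rewrite addn0.
by rewrite addnS big_ord_recr/= (le_trans IH)// lerDl sqr_ge0.
Qed.

Lemma subexp_gam_odd p : subexp (fun n => gam p (2 * n).+1).
Proof.
apply: (subexp_odd (a := gam p)); apply: subexp_sqrt; apply: subexpM.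
  by apply: subexp_bounded => n; exact: lexx.
by apply: subexp_pochhammer; [exact: ab2_gt0|exact: beta1_gt0].
Qed.

Definition scaled_coef p b : nat -> C := fun n => b n * (gam p (2 * n).+1)%:C.

Lemma subexp_scaled_coef p b M : (forall n, absc (b n) <= M) ->
  subexp (fun n => absc (scaled_coef p b n)).
Proof.
move=> bM.
have h : subexp (fun n => absc (b n) * gam p (2 * n).+1).
  apply: subexpM; last exact: subexp_gam_odd.
  by apply: (@subexp_bounded _ _ M) => n; rewrite ger0_norm ?absc_ge0.
apply: subexp_le h => n; rewrite /scaled_coef abscM absc_real.
by rewrite !normrM normr_id.
Qed.

(** All odd monomials share the factor z^(1 - p), and what remains is a power series
in z^2. *)
Definition odd_series p b : C -> C :=
  fun z => z * (z ^+ p)^-1 * Cpseries (scaled_coef p b) (z ^+ 2).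

Lemma Dstar_sqr z : Dstar z -> absc (z ^+ 2) < 1.
Proof. by case/andP=> z0 z1; rewrite abscX exprn_ilt1// ltW. Qed.

Lemma odd_series_holo p b M : (forall n, absc (b n) <= M) -> holomorphic_on Dstar (odd_series p b).
Proof.
move=> bM z Dz; apply: derivable_Cmul.
  apply: derivable_Cmul; first exact: (@derivable_Cexp _ 1).
  apply: derivable_Cinv; last exact: derivable_Cexp.
  by rewrite expf_neq0// Dstar_neq0.
apply: (@derivable_Ccomp _ (fun z => z ^+ 2)); first exact: derivable_Cexp.
by apply: derivable_Cpseries; [exact: subexp_scaled_coef bM|exact: Dstar_sqr].
Qed.

Lemma e_oddE p n z : Dstar z ->
  e_odd p n z = z * (z ^+ p)^-1 * ((gam p (2 * n).+1)%:C * (z ^+ 2) ^+ n).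
Proof.
move=> Dz; rewrite /e_odd /e_fun (exprzB _ _ (Dstar_neq0 Dz)) exprS exprM.
move: (_ %:C) (_ ^+ n) (z ^+ p)^-1 => a x y; ring.
Qed.

Lemma odd_series_conv p b M z : (forall n, absc (b n) <= M) -> Dstar z ->
  Cconv (fun n => b n * e_odd p n z) (odd_series p b z).
Proof.
move=> bM Dz.
have := CconvZ (z * (z ^+ p)^-1)
  (geom_bounded_conv (geom_bounded_pseries (subexp_scaled_coef p bM) (Dstar_sqr Dz))).
congr Cconv; apply/funext => n; rewrite (e_oddE _ _ Dz) /scaled_coef.
move: (_ %:C) (_ ^+ n) (z ^+ p)^-1 => a x y; ring.
Qed.

Lemma psum_holo p b N : holomorphic_on Dstar (psum p b N).
Proof.
elim: N => [|N IH] z Dz.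
  rewrite (_ : psum p b 0 = fun=> 0); first exact: derivable_cst.
  by apply/funext => w; rewrite /psum_of big_ord0.
rewrite (_ : psum p b N.+1 = fun w => psum p b N w + b N * e_odd p N w).
  apply: derivableD; first exact: IH.
  by apply: derivable_Cmul; [exact: derivable_cst|exact: e_fun_holo].
by apply/funext => w; rewrite /psum_of big_ord_recr.
Qed.

Lemma holo_sub f g : holomorphic_on Dstar f -> holomorphic_on Dstar g ->
  holomorphic_on Dstar (fun z => f z - g z).
Proof. by move=> hf hg z Dz; apply: derivableB; [exact: hf|exact: hg]. Qed.

Lemma psum_conv p b M z : (forall n, absc (b n) <= M) -> Dstar z ->
  forall eps, 0 < eps -> exists N, forall n, (N <= n)%N ->
    absc (psum p b n z - odd_series p b z) < eps.
Proof.
move=> bM Dz eps e0; have [N hN] := odd_series_conv p bM Dz e0.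
by exists N => n /hN; rewrite abscB.
Qed.

Lemma L2_of_normE p f B : Cmeasurable f -> (normE alpha (beta0 + p%:R) f <= B%:E)%E ->
  L2p p f.
Proof.
move=> mf nf; split => //; apply/integrableP; split.
  by apply/measurable_EFinP; exact: Cmeasurable_absc2.
rewrite (_ : \int[_]_(x in _) _ = normE alpha (beta0 + p%:R) f)%E.
  by rewrite (le_lt_trans nf)// ltry.
by apply: eq_integral => u _; rewrite gee0_abs// lee_fin sqr_ge0.
Qed.

Lemma L2_psum_e p b N : L2p p (psum p b N).
Proof. by apply: L2_psum => n; exact: e_odd_L2. Qed.

(** The L2 distance between two partial sums is a partial sum of squares, and the
partial sums converge pointwise; [fatou_norm] transfers the bound to the limit. *)
Lemma odd_series_tail p b M N : ell2 b M ->
  (normE alpha (beta0 + p%:R) (fun z => (odd_series p b z - psum p b N z)%R) <=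
   (M - \sum_(n < N) absc (b n) ^+ 2)%:E)%E.
Proof.
move=> bM; have bb := ell2_bounded bM.
apply: (@fatou_norm _ _ _ _ (fun k z => psum p b k z - psum p b N z)).
- by apply: holomorphic_Cmeasurable; apply: holo_sub; [exact: odd_series_holo bb|exact: psum_holo].
- by move=> k; apply: holomorphic_Cmeasurable; apply: holo_sub; exact: psum_holo.
- move=> z Dz e e0; have [k0 hk] := psum_conv p bb Dz e0.
  exists k0 => k /hk; congr (absc _ < _).
  move: (psum _ _ _ _) (psum _ _ _ _) (odd_series _ _ _) => x y F; ring.
- exists N => k Nk; rewrite norm2E; last first.
    by apply: L2B; exact: L2_psum_e.
  rewrite lee_fin (norm2_psum_sub (e_odd_L2 halpha hbeta p) (e_odd_orthonormal halpha hbeta p))//.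
  by rewrite lerB.
Qed.

Lemma odd_series_L2 p b M : ell2 b M -> L2p p (odd_series p b).
Proof.
move=> bM; apply: (@L2_of_normE _ _ M).
  by apply: holomorphic_Cmeasurable; exact: odd_series_holo (ell2_bounded bM).
have := @odd_series_tail p b M 0 bM; rewrite big_ord0 subr0.
congr (normE _ _ _ <= _)%E; apply/funext => z.
by rewrite /psum_of big_ord0 subr0.
Qed.

Lemma odd_series_approx p b M eps : ell2 b M -> 0 < eps ->
  exists N0, forall N, (N0 <= N)%N -> nrm p (fun z => odd_series p b z - psum p b N z) < eps.
Proof.
move=> bM e0; have e20 := divr_gt0 e0 (ltr0n R 2).
have [N0 bN0] := ell2_sharp bM e20; exists N0 => N NN.
have := odd_series_tail p N bN0; rewrite norm2E ?lee_fin; last first.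
  by apply: L2B; [exact: odd_series_L2 bM|exact: L2_psum_e].
have := sum_sqr_mono b NN; lra.
Qed.

Lemma odd_series_coef p b M n : ell2 b M -> dotp p (odd_series p b) (e_odd p n) = b n.
Proof.
move=> bM; apply: (coef_unique (e_odd_L2 halpha hbeta p) (e_odd_orthonormal halpha hbeta p)).
  exact: odd_series_L2 bM.
by move=> eps e0; exact: odd_series_approx bM e0.
Qed.

Lemma L2norm_lt p f eps : 0 < eps -> nrm p f < eps ^+ 2 ->
  L2norm alpha (beta0 + p%:R) f < eps.
Proof.
move=> e0 h; rewrite L2normE -[ltRHS](ger0_norm (ltW e0)) -sqrtr_sqr.
by rewrite ltr_sqrt// exprn_gt0.
Qed.

Lemma odd_series_O2 p b M : ell2 b M -> O2 p (odd_series p b).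
Proof.
move=> bM; split.
  by apply: L2_A2; [exact: odd_series_holo (ell2_bounded bM)|exact: odd_series_L2 bM].
move=> eps e0; have [N0 h] := odd_series_approx p bM (exprn_gt0 2 e0).
by exists N0, b; apply: L2norm_lt => //; exact: h.
Qed.

Definition odd_coefs p f : nat -> C := fun n => dotp p f (e_odd p n).

Lemma O2_L2 p f : O2 p f -> L2p p f.
Proof. by case=> /A2_L2. Qed.

Lemma odd_coefs_ell2 p f : O2 p f -> ell2 (odd_coefs p f) (nrm p f).
Proof.
move=> Of N; apply: (bessel (e_odd_L2 halpha hbeta p) (e_odd_orthonormal halpha hbeta p)).
exact: O2_L2.
Qed.

Lemma bessel_odd_coefs p f N : L2p p f ->
  nrm p (fun z => f z - psum p (odd_coefs p f) N z) =
  nrm p f - \sum_(n < N) absc (odd_coefs p f n) ^+ 2.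
Proof.
move=> Lf; rewrite (bessel_id (e_odd_L2 halpha hbeta p) (e_odd_orthonormal halpha hbeta p))//.
by rewrite [X in _ + X]big1 ?addr0// => i _; rewrite subrr absc0 expr0n.
Qed.

(** Among all combinations of the first monomials the orthogonal projection is the
closest to f by [bessel_id], so an arbitrary approximation may be replaced by
the partial sums with the coefficients of f. *)
Lemma O2_approx p f eps : O2 p f -> 0 < eps ->
  exists N0, forall N, (N0 <= N)%N ->
    nrm p (fun z => f z - psum p (odd_coefs p f) N z) < eps.
Proof.
move=> Of e0; have Lf := O2_L2 Of; case: Of => _ Hf.
have s0 : 0 < Num.sqrt eps by rewrite sqrtr_gt0.
have [N0 [a]] := Hf _ s0; rewrite L2normE ltr_sqrt// => ha.
exists N0 => N NN; rewrite bessel_odd_coefs//.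
have := sum_sqr_mono (odd_coefs p f) NN.
have := bessel_id (e_odd_L2 halpha hbeta p) (e_odd_orthonormal halpha hbeta p) a N0 Lf.
have : 0 <= \sum_(n < N0) absc (a n - odd_coefs p f n) ^+ 2.
  by apply: sumr_ge0 => i _; exact: sqr_ge0.
rewrite -/(psum p a N0) in ha *.
rewrite /odd_coefs; lra.
Qed.

(** The partial sums converge to f in norm and to the series pointwise, so by
[fatou_norm] the difference has norm 0, and [norm0_eq0] applies to it. *)
Lemma O2_expand p f z : O2 p f -> Dstar z -> f z = odd_series p (odd_coefs p f) z.
Proof.
move=> Of Dz; have bM := odd_coefs_ell2 Of; have bb := ell2_bounded bM.
have hf : holomorphic_on Dstar f by case: Of => -[].
have hF := @odd_series_holo p _ _ bb.
have hfF := holo_sub hf hF.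
apply/eqP; rewrite -subr_eq0; apply/eqP.
apply: (@norm0_eq0 R alpha (beta0 + p%:R) halpha (betaDn_gtN1 hbeta p)
  (fun z => f z - odd_series p (odd_coefs p f) z) hfF) => //.
apply/eqP; rewrite eq_le normE_ge0 andbT.
apply/lee_addgt0Pr => eps e0; rewrite add0e.
apply: (@fatou_norm _ _ _ _ (fun k z => f z - psum p (odd_coefs p f) k z)).
- exact: holomorphic_Cmeasurable.
- by move=> k; apply: holomorphic_Cmeasurable; apply: holo_sub; [exact: hf|exact: psum_holo].
- move=> w Dw e e0'; have [k0 hk] := psum_conv p bb Dw e0'.
  exists k0 => k /hk; rewrite abscB; congr (absc _ < _).
  move: (psum _ _ _ _) (f w) (odd_series _ _ _) => x y F; ring.
- have [N0 hN] := O2_approx Of e0; exists N0 => k /hN h.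
  rewrite norm2E; first by rewrite lee_fin ltW.
  by apply: L2B; [exact: O2_L2|exact: L2_psum_e].
Qed.

(** Both squared norms are the supremum of the same partial sums of squares. *)
Lemma parseval p q f g : O2 p f -> O2 q g -> odd_coefs p f = odd_coefs q g ->
  nrm p f = nrm q g.
Proof.
move=> Of Og E; apply/eqP; rewrite eq_le; apply/andP; split.
  apply/ler_addgt0Pr => eps e0.
  have [N hN] := O2_approx Of e0; have := hN N (leqnn N).
  rewrite bessel_odd_coefs; last exact: O2_L2.
  have := odd_coefs_ell2 Og N; rewrite E.
  move: (norm2 _ _ f) (norm2 _ _ g) (\sum_(n < N) _) => x y S; lra.
apply/ler_addgt0Pr => eps e0.
have [N hN] := O2_approx Og e0; have := hN N (leqnn N).
rewrite bessel_odd_coefs; last exact: O2_L2.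
have := odd_coefs_ell2 Of N; rewrite E.
move: (norm2 _ _ f) (norm2 _ _ g) (\sum_(n < N) _) => x y S; lra.
Qed.

End expansion.

(** * The kernel and the transform *)

Section kernel.
Variables (R : realType) (alpha beta0 : R).
Hypotheses (halpha : -1 < alpha) (hbeta : -1 < beta0).
Local Notation C := R[i].
Local Notation Dstar := (@Dstar R).
Local Notation gam := (gamma_coef alpha beta0).
Local Notation e_odd := (e_odd alpha beta0).
Local Notation O2 := (O2 alpha beta0).
Local Notation odd_coefs := (odd_coefs alpha beta0).
Local Notation odd_series := (odd_series alpha beta0).
Local Notation Jk := (J_kernel alpha beta0).
Local Notation J := (J_transform alpha beta0).
Local Notation poch := (@pochhammer R).
Implicit Types (f g : C -> C) (z w : C) (p q n k N : nat) (b : nat -> C).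

(** Split the factors of (a)_(2n+1) after the first one by the parity of their
index and take a 2 out of each. *)
Lemma pochhammer_odd (a : R) n : poch a (2 * n).+1 =
  a * 4 ^+ n * (poch ((a + 1) / 2) n * poch ((a + 2) / 2) n).
Proof.
elim: n => [|n IH]; first by rewrite muln0 /pochhammer big_ord1 !big_ord0 addr0 !mulr1.
have -> : (2 * n.+1).+1 = (2 * n).+1.+2 by rewrite mulnS.
rewrite 2!pochhammerS IH !(pochhammerS _ n) exprS.
have -> : (2 * n).+1%:R = 2 * n%:R + 1 :> R by rewrite -addn1 natrD natrM.
have -> : (2 * n).+2%:R = 2 * n%:R + 2 :> R by rewrite -addn2 natrD natrM.
move: (poch _ _) (poch _ _) (4 ^+ n) n%:R => x y t m; by field.
Qed.

Lemma pochhammerC (x : R) n : pochhammer x%:C n = (poch x n)%:C.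
Proof.
rewrite /pochhammer rmorph_prod; apply: eq_bigr => i _.
by rewrite rmorphD rmorph_nat.
Qed.

Lemma pochhammer1 n : pochhammer (1 : C) n = n`!%:R.
Proof.
elim: n => [|n IH]; first by rewrite /pochhammer big_ord0.
by rewrite /pochhammer big_ord_recr -/(pochhammer 1 n)/= IH factS natrM mulrC nat1r.
Qed.

(** The coefficients of the hypergeometric series: the parameter 1 contributes
(1)_n = n!, which cancels the factorial. *)
Definition kappa n : R :=
  poch ((alpha + beta0 + 3) / 2) n / poch ((beta0 + 2) / 2) n *
  (poch ((alpha + beta0 + 4) / 2) n / poch ((beta0 + 3) / 2) n).

Let A3_gt0 : 0 < (alpha + beta0 + 3) / 2. Proof. by have := halpha; have := hbeta; lra. Qed.
Let A4_gt0 : 0 < (alpha + beta0 + 4) / 2. Proof. by have := halpha; have := hbeta; lra. Qed.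
Let B2_gt0 : 0 < (beta0 + 2) / 2. Proof. by have := halpha; have := hbeta; lra. Qed.
Let B3_gt0 : 0 < (beta0 + 3) / 2. Proof. by have := halpha; have := hbeta; lra. Qed.

Lemma subexp_kappa : subexp kappa.
Proof. by apply: subexpM; exact: subexp_pochhammer. Qed.

Lemma gamma_mul p q n : gam p n * gam q n =
  c_coef alpha beta0 p q * (poch (alpha + beta0 + 2) n / poch (beta0 + 1) n).
Proof.
have P0 k : 0 < poch (beta0 + 1) k by rewrite pochhammer_gt0// beta1_gt0.
have Q0 k : 0 < poch (alpha + beta0 + 2) k by rewrite pochhammer_gt0// ab2_gt0.
have r0 : 0 <= poch (alpha + beta0 + 2) n / poch (beta0 + 1) n.
  by rewrite divr_ge0// ltW.
rewrite -[in RHS](ger0_norm r0) -sqrtr_sqr -!sqrtrM; last 2 first.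
- by rewrite divr_ge0// mulr_ge0// ltW.
- by rewrite mulr_ge0// divr_ge0// ltW.
congr Num.sqrt; have := P0 p; have := P0 q; have := P0 n.
have := Q0 p; have := Q0 q; have := Q0 n.
move: (poch _ p) (poch _ q) (poch _ n) (poch _ p) (poch _ q) (poch _ n).
by move=> a b c d e f f0 e0 d0 c0 b0 a0; field; rewrite !gt_eqF.
Qed.

Lemma gamma_mul_odd p q n : gam p (2 * n).+1 * gam q (2 * n).+1 =
  (alpha + beta0 + 2) / (beta0 + 1) * c_coef alpha beta0 p q * kappa n.
Proof.
rewrite gamma_mul !pochhammer_odd /kappa.
have -> : alpha + beta0 + 2 + 1 = alpha + beta0 + 3 by ring.
have -> : alpha + beta0 + 2 + 2 = alpha + beta0 + 4 by ring.
have -> : beta0 + 1 + 1 = beta0 + 2 by ring.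
have -> : beta0 + 1 + 2 = beta0 + 3 by ring.
have := pochhammer_gt0 n B2_gt0; have := pochhammer_gt0 n B3_gt0.
have b10 := beta1_gt0 hbeta.
have t0 : 0 < 4 ^+ n :> R by rewrite exprn_gt0.
move: (poch _ n) (poch _ n) (poch _ n) (poch _ n) (4 ^+ n) t0 => a b c d t t0 d0 c0.
by field; rewrite !gt_eqF.
Qed.

(** The limit defining the hypergeometric function carries information only once
the series is known to converge. *)
Lemma hypergeometric_conv (xi : C) : absc xi < 1 ->
  Cconv (fun n => (kappa n)%:C * xi ^+ n)
    (hypergeometric3F2 1
      ((alpha + beta0 + 3) / 2)%:C ((alpha + beta0 + 4) / 2)%:C
      ((beta0 + 2) / 2)%:C ((beta0 + 3) / 2)%:C xi).
Proof.
move=> xi1.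
have sk : subexp (fun n => absc (kappa n)%:C).
  by apply: subexp_le subexp_kappa => n; rewrite absc_real normr_id.
have h := geom_bounded_conv (geom_bounded_pseries sk xi1).
rewrite /hypergeometric3F2 [X in series X](_ : _ = (fun n => (kappa n)%:C * xi ^+ n)).
  by rewrite [limn _](Cconv_lim h).
apply/funext => n.
have -> : pochhammer 1 n = n`!%:R :> C := pochhammer1 n.
rewrite !pochhammerC /kappa.
have n0 : n`!%:R != 0 :> C by rewrite pnatr_eq0 -lt0n fact_gt0.
have invC (x : R) : (x^-1)%:C = x%:C^-1 by exact: (fmorphV (real_complex R)).
have mulC (x y : R) : (x * y)%:C = x%:C * y%:C by exact: (rmorphM (real_complex R)).
rewrite !mulC !invC.
have := pochhammer_gt0 n B2_gt0; have := pochhammer_gt0 n B3_gt0.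
move: (poch _ n) (poch _ n) (poch _ n) (poch _ n) => a b c d d0 c0.
have d0' : d%:C != 0 by rewrite eq_complex/= gt_eqF.
have c0' : c%:C != 0 by rewrite eq_complex/= gt_eqF.
move: (n`!%:R) n0 (xi ^+ n) (a%:C) (b%:C) (c%:C) (d%:C) d0' c0' => F F0 x a' b' c' d' d0' c0'.
by field; rewrite ?F0 ?d0' ?c0'.
Qed.

Lemma e_odd_conj p n w : Dstar w -> (e_odd p n w)^* =
  w^* * (w^* ^+ p)^-1 * ((gam p (2 * n).+1)%:C * (w^* ^+ 2) ^+ n).
Proof.
move=> Dw; rewrite (e_oddE alpha beta0 p n Dw) !(rmorphM Num.conj).
rewrite (fmorphV Num.conj) !(rmorphXn Num.conj).
by congr (_ * (_ * _)); exact: conj_realC.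
Qed.

(** The orthonormal expansion of the kernel; termwise it is [gamma_mul_odd]. *)
Lemma kernel_conv p q z w : Dstar z -> Dstar w ->
  Cconv (fun n => (e_odd p n w)^* * e_odd q n z) (Jk p q z w).
Proof.
move=> Dz Dw.
have xi1 : absc ((w^* * z) ^+ 2) < 1.
  rewrite abscX abscM absc_conj; case/andP: Dz => z0 z1; case/andP: Dw => w0 w1.
  by rewrite exprn_ilt1 ?mulr_ge0 ?absc_ge0// mulr_ilt1 ?absc_ge0.
have := CconvZ (((alpha + beta0 + 2) / (beta0 + 1))%:C
  * ((c_coef alpha beta0 p q)%:C / (w^* ^ (p%:Z - 1) * z ^ (q%:Z - 1)))) (hypergeometric_conv xi1).
congr Cconv; apply/funext => n.
have z0 := Dstar_neq0 Dz; have w0 := Dstar_neq0 Dw.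
have wc0 : w^* != 0 by rewrite conjC_eq0.
have e1 x k : x != 0 -> x ^ (k%:Z - 1) = x ^+ k / x :> C.
  by move=> x0; rewrite (exprzB k 1 x0) expr1.
rewrite (e_odd_conj p n Dw) (e_oddE alpha beta0 q n Dz) (e1 _ p wc0) (e1 _ q z0).
have G : (gam p (2 * n).+1)%:C * (gam q (2 * n).+1)%:C =
  ((alpha + beta0 + 2) / (beta0 + 1))%:C * (c_coef alpha beta0 p q)%:C * (kappa n)%:C.
  by rewrite -!rmorphM gamma_mul_odd.
transitivity (w^* * z / (w^* ^+ p * z ^+ q) * ((w^* * z) ^+ 2) ^+ n *
   ((gam p (2 * n).+1)%:C * (gam q (2 * n).+1)%:C)).
  rewrite G; have := expf_neq0 p wc0; have := expf_neq0 q z0.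
  move: (_ ^+ q) (_ ^+ p) (_ ^+ n) (_ %:C) (_ %:C) (_ %:C) => x y t a b c x0 y0.
  by field; rewrite x0 y0 wc0 z0.
rewrite !exprMn.
have := expf_neq0 p wc0; have := expf_neq0 q z0.
move: (_ ^+ q) (_ ^+ p) => x y x0 y0.
by field; rewrite x0 y0.
Qed.

Lemma Cconv_conj (u : nat -> C) (l : C) : Cconv u l -> Cconv (fun n => (u n)^*) l^*.
Proof.
move=> h e e0; have [N hN] := h e e0; exists N => n /hN.
by rewrite -(rmorph_sum Num.conj) -(rmorphB Num.conj) absc_conj.
Qed.

(** The coefficients in O_p of the conjugate of the kernel at z. *)
Definition kernel_coef q z : nat -> C := fun n => (e_odd q n z)^*.

(** The squares are of the form c a_n |z|^(4n) with a_n subexponential, so they are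
dominated by a geometric series. *)
Lemma kernel_coef_ell2 q z : Dstar z -> exists M, ell2 (kernel_coef q z) M.
Proof.
move=> Dz; have z1 := Dstar_sqr Dz.
have s2 : subexp (fun n => gam q (2 * n).+1 * gam q (2 * n).+1).
  by apply: subexpM; exact: subexp_gam_odd.
have r01 : 0 <= absc (z ^+ 2) ^+ 2 < 1.
  by rewrite exprn_ge0 ?absc_ge0//= exprn_ilt1 ?absc_ge0.
have [K [t [K0 t01 hK]]] := subexp_geometric s2 r01.
have /andP[t0 t1] := t01.
pose c := absc (z * (z ^+ q)^-1) ^+ 2.
exists (c * (K / (1 - t))) => N.
have c0 : 0 <= c by exact: sqr_ge0.
have term n : absc (kernel_coef q z n) ^+ 2 <= c * (K * t ^+ n).
  rewrite /kernel_coef absc_conj (e_oddE alpha beta0 q n Dz) abscM exprMn ler_wpM2l//.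
  apply: le_trans (hK n); rewrite abscM absc_real abscX.
  by rewrite exprMn -[X in X * _]normrX expr2 -!exprM mulnC.
apply: (@le_trans _ _ (\sum_(n < N) c * (K * t ^+ n))); first exact: ler_sum.
rewrite -mulr_sumr ler_wpM2l// -mulr_sumr ler_wpM2l//.
have t10 : 0 < 1 - t by rewrite subr_gt0.
rewrite -[leRHS]mul1r ler_pdivlMr//.
have -> : (\sum_(n < N) t ^+ n) * (1 - t) = 1 - t ^+ N.
  by rewrite -[RHS]opprB subrX1 -mulNr opprB mulrC.
by rewrite lerBlDr lerDl exprn_ge0.
Qed.

Lemma conj_kernel p q z w : Dstar z -> Dstar w ->
  odd_series p (kernel_coef q z) w = (Jk p q z w)^*.
Proof.
move=> Dz Dw; have [M hM] := kernel_coef_ell2 q Dz.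
apply: Cconv_unique (odd_series_conv halpha hbeta p (ell2_bounded hM) Dw) _.
have := Cconv_conj (kernel_conv p q Dz Dw).
congr Cconv; apply/funext => n; rewrite /kernel_coef.
move: (e_odd p n w) (e_odd q n z) => x y.
by rewrite (rmorphM Num.conj) mulrC; congr (_ * _); exact: conjCK.
Qed.

Lemma conj_kernel_L2 p q z : Dstar z ->
  Cmeasurable (fun w => (Jk p q z w)^*) /\
  L2 alpha (beta0 + p%:R) (fun w => (Jk p q z w)^*).
Proof.
move=> Dz; have [M hM] := kernel_coef_ell2 q Dz.
have mk : Cmeasurable (fun w => (Jk p q z w)^*).
  apply: holomorphic_Cmeasurable.
  have hF := @odd_series_holo R alpha beta0 halpha hbeta p _ _ (ell2_bounded hM).
  have E w : Dstar w -> odd_series p (kernel_coef q z) w = (Jk p q z w)^* by exact: conj_kernel.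
  exact: (eq_holomorphic E hF).
split => //; apply: (eq_L2 mk _ (odd_series_L2 halpha hbeta p hM)) => w Dw.
exact: conj_kernel.
Qed.

Lemma J_integrand p q f z :
  (fun w => f w * Jk p q z w) = (fun w => f w * ((Jk p q z w)^*)^*).
Proof. by apply/funext => w; rewrite conjCK. Qed.

(** The conjugate of the kernel is square integrable in w, so the integrand is a
product of two L2 functions. *)
Lemma J_integrable p q f z : O2 p f -> Dstar z ->
  Cintegrable alpha (beta0 + p%:R) (fun w => f w * Jk p q z w).
Proof.
move=> Of Dz; rewrite J_integrand.
exact: (L2_dot (O2_L2 Of) (conj_kernel_L2 p q Dz).2).
Qed.

(** J f(z) is the inner product of f with the conjugate kernel H.  For a partial
sum S_n of f the inner product with H is the n-th partial sum of the series on
the right, and by Cauchy-Schwarz replacing f by S_n costs at most the norm of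
f - S_n times that of H. *)
Lemma J_expand p q f z : O2 p f -> Dstar z -> J p q f z = odd_series q (odd_coefs p f) z.
Proof.
move=> Of Dz; have [M hM] := kernel_coef_ell2 q Dz.
have Lf := O2_L2 Of; have LF := odd_series_L2 halpha hbeta p hM.
have -> : J p q f z = L2dot alpha (beta0 + p%:R) f (odd_series p (kernel_coef q z)).
  rewrite /J_transform J_integrand; apply/esym.
  apply: (eq_dot Lf LF Lf.1 (conj_kernel_L2 p q Dz).1) => // w Dw.
  exact: conj_kernel.
have bb := ell2_bounded (odd_coefs_ell2 halpha hbeta Of).
apply: Cconv_unique _ (odd_series_conv halpha hbeta q bb Dz) => e e0.
set H := odd_series p (kernel_coef q z).
(* Cauchy-Schwarz is used with a positive bound, hence the + 1 *)
pose B := norm2 alpha (beta0 + p%:R) H + 1.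
have B0 : 0 < B by rewrite ltr_wpDl// norm2_ge0.
have HB : norm2 alpha (beta0 + p%:R) H <= B by rewrite lerDl.
have e20 : 0 < e ^+ 2 / B by rewrite divr_gt0// exprn_gt0.
have [N hN] := O2_approx halpha hbeta Of e20.
exists N => n /hN nN.
have LS := L2_psum_e halpha hbeta p (odd_coefs p f) n.
have E : \sum_(k < n) odd_coefs p f k * e_odd q k z =
    L2dot alpha (beta0 + p%:R) (psum_of (e_odd p) (odd_coefs p f) n) H.
  rewrite (dot_psum (e_odd_L2 halpha hbeta p) _ _ LF); apply: eq_bigr => k _.
  rewrite (dot_conj LF (e_odd_L2 halpha hbeta p k)) (odd_series_coef halpha hbeta p k hM).
  by rewrite /kernel_coef conjCK.
rewrite E -(dotBl Lf LS LF).
rewrite -(ltr_pXn2r (n := 2)) ?nnegrE ?absc_ge0 ?(ltW e0)//.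
apply: (le_lt_trans (cauchy_schwarz (L2B Lf LS) LF B0 HB)).
by rewrite mulrC -ltr_pdivlMr.
Qed.

Lemma eq_O2 p f g : (forall z, Dstar z -> f z = g z) -> O2 p f -> O2 p g.
Proof.
move=> fg Of; have Lf := O2_L2 Of; case: Of => -[hf _] Hf.
have hg := eq_holomorphic fg hf.
have mg := holomorphic_Cmeasurable hg.
have Lg := eq_L2 mg fg Lf.
split; first exact: L2_A2.
move=> eps e0; have [N [a h]] := Hf _ e0; exists N, a.
have LS := L2_psum_e halpha hbeta p a N.
have LfS := L2B Lf LS; have LgS := L2B Lg LS.
rewrite /L2norm; have <- : L2dot alpha (beta0 + p%:R)
    (fun z => f z - psum_of (e_odd p) a N z) (fun z => f z - psum_of (e_odd p) a N z) =
  L2dot alpha (beta0 + p%:R)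
    (fun z => g z - psum_of (e_odd p) a N z) (fun z => g z - psum_of (e_odd p) a N z).
  by apply: (eq_dot LfS LfS LgS.1 LgS.1) => z Dz; rewrite fg.
exact: h.
Qed.

Lemma J_O2 p q f : O2 p f -> O2 q (J p q f).
Proof.
move=> Of; apply: (eq_O2 _ (odd_series_O2 halpha hbeta q (odd_coefs_ell2 halpha hbeta Of))).
by move=> z Dz; rewrite J_expand.
Qed.

(** By [J_expand], J f is the series with the coefficients of f. *)
Lemma odd_coefs_J p q f : O2 p f -> odd_coefs q (J p q f) = odd_coefs p f.
Proof.
move=> Of; apply/funext => n; have h := odd_coefs_ell2 halpha hbeta Of.
rewrite -(odd_series_coef halpha hbeta q n h); apply/esym.
have LF := odd_series_L2 halpha hbeta q h; have Le := e_odd_L2 halpha hbeta q n.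
apply: (eq_dot LF Le (O2_L2 (J_O2 q Of)).1 Le.1) => // z Dz.
by rewrite J_expand.
Qed.

Lemma J_norm p q f : O2 p f ->
  L2norm alpha (beta0 + q%:R) (J p q f) = L2norm alpha (beta0 + p%:R) f.
Proof.
move=> Of.
exact: (congr1 Num.sqrt (parseval halpha hbeta (J_O2 q Of) Of (odd_coefs_J q Of))).
Qed.

(** J_(q,p) resums in O_p the coefficients of J_(p,q) f, which are those of f. *)
Lemma J_inv p q f z : O2 p f -> Dstar z -> J q p (J p q f) z = f z.
Proof.
move=> Of Dz; rewrite (J_expand p (J_O2 q Of) Dz) odd_coefs_J//.
by rewrite -(O2_expand halpha hbeta Of Dz).
Qed.

End kernel.

Theorem theorem5 (R : realType) (alpha beta0 : R)
    (halpha : -1 < alpha) (hbeta0 : -1 < beta0 <= 0) (p q : nat) :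
  let O := O2 alpha beta0 in
  let J := J_transform alpha beta0 in
  let norm n := L2norm alpha (beta0 + n%:R) in
  [/\ (* the integral defining the transform converges absolutely *)
      forall f z, O p f -> Dstar z ->
        Cintegrable alpha (beta0 + p%:R)
          (fun w => f w * J_kernel alpha beta0 p q z w),
      (* J p q is linear *)
      forall (a : R[i]) f g z, O p f -> O p g -> Dstar z ->
        J p q (fun w => a * f w + g w) z = a * J p q f z + J p q g z,
      (* it maps O p into O q, preserving the norm *)
      forall f, O p f -> O q (J p q f) /\ norm q (J p q f) = norm p f,
      (* it is onto O q *)
      forall g, O q g ->
        exists2 f, O p f & forall z, Dstar z -> J p q f z = g z &
      (* its inverse is J q p *)
      (forall f, O p f -> forall w, Dstar w -> J q p (J p q f) w = f w) /\
      (forall g, O q g -> O p (J q p g) /\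
        forall z, Dstar z -> J p q (J q p g) z = g z)].
Proof.
case/andP: hbeta0 => hbeta _ O J norm; split.
- by move=> f z Of Dz; exact: J_integrable.
- move=> a f g z Of Og Dz.
  have If := J_integrable halpha hbeta q Of Dz.
  have Ig := J_integrable halpha hbeta q Og Dz.
  rewrite /J /J_transform -(CintegralZ a If) -(CintegralD (CintegrableZ a If) Ig).
  by congr (Cintegral _ _ _); apply/funext => w; rewrite mulrDl mulrA.
- move=> f Of; have OJ := J_O2 halpha hbeta q Of; split; first exact: OJ.
  exact (J_norm halpha hbeta q Of).
- move=> g Og; exists (J q p g); first exact: J_O2.
  by move=> z Dz; exact: J_inv.
- split; first by move=> f Of w Dw; exact: J_inv.
  by move=> g Og; split; [exact: J_O2|move=> z Dz; exact: J_inv].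
Qed.
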